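(* Over IZF, the following are equivalent: (a) every enumerable positive coherent theory $\mathbb{T}$ is complete with respect to enumerable model diagrams (every positive coherent sequent over the signature of $\mathbb{T}$ true in all enumerable $\mathbb{T}$-model diagrams is provable in $\mathbb{T}$); (b) the Fan Theorem (for decidable bars).
   Context: A signature is a set of relation symbols with finite arities (single-sorted, containing $=$). Sequents $\phi\vdash_{\mathbf{x}}\psi$ express $\forall\mathbf{x}(\phi\to\psi)$; deduction is intuitionistic free logic. Positive coherent formulas are built from atomic formulas using $\top,\wedge,\vee,\exists$; a positive coherent theory is a set of positive coherent sequents. A set is enumerable if it is a semi-decidable subset $\{a\in A:\exists n\,f(a)(n)=1\}$ of a countable set $A$; a theory is enumerable if its signature and set of axioms are enumerable. A diagram is a structure together with a congruence interpreting $=$; a $\mathbb{T}$-model diagram satisfies all axioms of $\mathbb{T}$; it is enumerable if its domain and the interpretations of $=$ and all relation symbols are enumerable. Fan Theorem (FAN$_D$): in a fan (finitely branching spread), every decidable bar is uniform. *)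

(* Defs.v *)
(* Constructive reverse mathematics, read in the intuitionistic logic of Rocq's
   [Prop]; only axiom-free libraries are loaded, and no choice principle or
   excluded middle is assumed.  Sets are types or [Prop]-valued predicates
   (impredicative, as Power Set and full Separation require).  Rocq has no
   unique choice, whereas a function of set theory is a total single-valued
   relation: hence the infinitary functions whose existence is at stake
   (bijections, characteristic functions, paths) are given as relations.  In
   particular a map X -> 2 is a predicate P with [P x \/ ~ P x] for all x. *)
From Stdlib Require List.
From mathcomp Require Import all_boot.
Set Implicit Arguments.
Unset Strict Implicit.
Unset Printing Implicit Defensive.

Definition decidable_on (X : Type) (P Q : X -> Prop) : Prop :=
  forall x, P x -> Q x \/ ~ Q x.

Definition full (X : Type) : X -> Prop := fun=> True.

Definition equipotent (X Y : Type) (P : X -> Prop) (Q : Y -> Prop) : Prop :=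
  exists G : X -> Y -> Prop,
    [/\ forall x y, G x y -> P x /\ Q y,
        forall x, P x -> exists! y, G x y
      & forall y, Q y -> exists! x, G x y].

Definition countable (A : Type) : Prop := equipotent (@full A) (@full nat).

(* [f a n] stands for f(a)(n) = 1.  The type [A] need not be related to [X], so
   "is a semi-decidable subset of A" becomes "is in bijection with" one. *)
Definition enumerable (X : Type) (P : X -> Prop) : Prop :=
  exists (A : Type) (f : A -> nat -> Prop),
    [/\ countable A,
        decidable_on (@full (A * nat)) (fun u => f u.1 u.2)
      & equipotent P (fun a => exists n, f a n)].

Record signature := Signature { symbol : Type; arity : symbol -> nat }.

(* [form S n]: first-order formulas in a context of n variables; in [All] and
   [Ex] the bound variable is [ord0] and the others are lifted. *)
Inductive form (S : signature) (n : nat) : Type :=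
| Rel (R : symbol S) (args : (arity R).-tuple 'I_n)
| Eq (i j : 'I_n)
| Top
| Bot
| And (p q : form S n)
| Or (p q : form S n)
| Imp (p q : form S n)
| All (p : form S n.+1)
| Ex (p : form S n.+1).

Arguments Rel {S n} R args.
Arguments Eq {S n} i j.
Arguments Top {S n}.
Arguments Bot {S n}.

Definition scons (X : Type) (n : nat) (x : X) (e : 'I_n -> X) : 'I_n.+1 -> X :=
  fun i => if unlift ord0 i is Some j then e j else x.

Definition shift {n : nat} : 'I_n -> 'I_n.+1 := lift ord0.

Definition up (m n : nat) (r : 'I_m -> 'I_n) : 'I_m.+1 -> 'I_n.+1 :=
  scons ord0 (fun i => shift (r i)).

(* The only terms are variables, so substitutions are maps of variables. *)
Fixpoint subst (S : signature) (m n : nat) (r : 'I_m -> 'I_n)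
    (p : form S m) {struct p} : form S n :=
  match p with
  | Rel R args => Rel R [tuple of map r args]
  | Eq i j => Eq (r i) (r j)
  | Top => Top
  | Bot => Bot
  | And p q => And (subst r p) (subst r q)
  | Or p q => Or (subst r p) (subst r q)
  | Imp p q => Imp (subst r p) (subst r q)
  | All p => All (subst (up r) p)
  | Ex p => Ex (subst (up r) p)
  end.

Definition inst (S : signature) (n : nat) (i : 'I_n) (p : form S n.+1) :
  form S n := subst (scons i id) p.

Fixpoint positive_coherent (S : signature) (n : nat) (p : form S n) : bool :=
  match p with
  | Rel _ _ | Eq _ _ | Top => true
  | And p q | Or p q => positive_coherent p && positive_coherent q
  | Ex p => positive_coherent p
  | Bot | Imp _ _ | All _ => false
  end.

Record sequent (S : signature) := Sequent {
  context : nat;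
  antecedent : form S context;
  succedent : form S context
}.

Definition positive_coherent_sequent (S : signature) (s : sequent S) : bool :=
  positive_coherent (antecedent s) && positive_coherent (succedent s).

Definition theory (S : signature) := sequent S -> Prop.

Definition positive_coherent_theory (S : signature) (T : theory S) : Prop :=
  forall s, T s -> positive_coherent_sequent s.

Definition enumerable_theory (S : signature) (T : theory S) : Prop :=
  enumerable (@full (symbol S)) /\ enumerable T.

(* Natural deduction for intuitionistic logic with explicit variable contexts.
   The logic is free: [d_AllE], [d_ExI] and [d_EqI] only use variables of the
   current context, so no element is assumed to exist in the empty context. *)
Inductive deriv (S : signature) (T : theory S) (n : nat)
    (G : seq (form S n)) : form S n -> Prop :=
| d_Ax m (p q : form S m) (r : 'I_m -> 'I_n) :
    T (Sequent p q) -> deriv T G (subst r p) -> deriv T G (subst r q)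
| d_Hyp p : List.In p G -> deriv T G p
| d_TopI : deriv T G Top
| d_BotE p : deriv T G Bot -> deriv T G p
| d_AndI p q : deriv T G p -> deriv T G q -> deriv T G (And p q)
| d_AndEl p q : deriv T G (And p q) -> deriv T G p
| d_AndEr p q : deriv T G (And p q) -> deriv T G q
| d_OrIl p q : deriv T G p -> deriv T G (Or p q)
| d_OrIr p q : deriv T G q -> deriv T G (Or p q)
| d_OrE p q c :
    deriv T G (Or p q) -> deriv T (p :: G) c -> deriv T (q :: G) c ->
    deriv T G c
| d_ImpI p q : deriv T (p :: G) q -> deriv T G (Imp p q)
| d_ImpE p q : deriv T G (Imp p q) -> deriv T G p -> deriv T G q
| d_AllI p : deriv T (map (subst shift) G) p -> deriv T G (All p)
| d_AllE p i : deriv T G (All p) -> deriv T G (inst i p)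
| d_ExI p i : deriv T G (inst i p) -> deriv T G (Ex p)
| d_ExE p c :
    deriv T G (Ex p) ->
    deriv T (p :: map (subst shift) G) (subst shift c) -> deriv T G c
| d_EqI i : deriv T G (Eq i i)
| d_EqE (p : form S n.+1) i j :
    deriv T G (Eq i j) -> deriv T G (inst i p) -> deriv T G (inst j p).

Definition provable (S : signature) (T : theory S) (s : sequent S) : Prop :=
  deriv T [:: antecedent s] (succedent s).

Record diagram (S : signature) := Diagram {
  dom : Type;
  deq : dom -> dom -> Prop;
  drel : forall R : symbol S, (arity R).-tuple dom -> Prop;
  deq_refl : forall x, deq x x;
  deq_sym : forall x y, deq x y -> deq y x;
  deq_trans : forall x y z, deq x y -> deq y z -> deq x z;
  drel_congr : forall (R : symbol S) (u v : (arity R).-tuple dom),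
    (forall i, deq (tnth u i) (tnth v i)) -> drel u -> drel v
}.

Arguments deq {S} d x y.
Arguments drel {S} d {R} u.

Fixpoint sat (S : signature) (D : diagram S) (n : nat) (e : 'I_n -> dom D)
    (p : form S n) {struct p} : Prop :=
  match p with
  | Rel R args => drel D [tuple of map e args]
  | Eq i j => deq D (e i) (e j)
  | Top => True
  | Bot => False
  | And p q => sat e p /\ sat e q
  | Or p q => sat e p \/ sat e q
  | Imp p q => sat e p -> sat e q
  | All p => forall x, sat (scons x e) p
  | Ex p => exists x, sat (scons x e) p
  end.

Definition true_in (S : signature) (D : diagram S) (s : sequent S) : Prop :=
  forall e : 'I_(context s) -> dom D,
    sat e (antecedent s) -> sat e (succedent s).

Definition model_diagram (S : signature) (T : theory S) (D : diagram S) :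
  Prop := forall s, T s -> true_in D s.

Definition enumerable_diagram (S : signature) (D : diagram S) : Prop :=
  [/\ enumerable (@full (dom D)),
      enumerable (fun u : dom D * dom D => deq D u.1 u.2)
    & forall R : symbol S,
        enumerable (fun u : (arity R).-tuple (dom D) => drel D u)].

Definition complete_wrt_enumerable_diagrams (S : signature) (T : theory S) :
  Prop :=
  forall s : sequent S, positive_coherent_sequent s ->
    (forall D : diagram S,
       enumerable_diagram D -> model_diagram T D -> true_in D s) ->
    provable T s.

Definition enumerable_completeness : Prop :=
  forall (S : signature) (T : theory S),
    positive_coherent_theory T -> enumerable_theory T ->
    complete_wrt_enumerable_diagrams T.

Definition spread (F : seq nat -> Prop) : Prop :=
  [/\ decidable_on (@full (seq nat)) F,
      F [::]
    & forall s, F s <-> exists k, F (rcons s k)].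

Definition fan (F : seq nat -> Prop) : Prop :=
  spread F /\
  forall s, F s -> exists b, forall k, F (rcons s k) -> k <= b.

Definition initial_segment (alpha : nat -> nat -> Prop) (s : seq nat) : Prop :=
  forall i, i < size s -> alpha i (nth 0 s i).

(* [alpha i k] stands for alpha(i) = k. *)
Definition path_in (F : seq nat -> Prop) (alpha : nat -> nat -> Prop) : Prop :=
  (forall i, exists! k, alpha i k) /\
  (forall s, initial_segment alpha s -> F s).

Definition bar (F B : seq nat -> Prop) : Prop :=
  forall alpha, path_in F alpha -> exists s, initial_segment alpha s /\ B s.

Definition uniform_bar (F B : seq nat -> Prop) : Prop :=
  exists m, forall alpha, path_in F alpha ->
    exists s, [/\ initial_segment alpha s, size s <= m & B s].

Definition FAN_D : Prop :=
  forall F B : seq nat -> Prop,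
    fan F -> decidable_on F B -> bar F B -> uniform_bar F B.

(* Main.v *)
(** (a) implies (b).  A decidable bar B of a fan F is turned into a theory whose
   models follow a path of F: |- P_nil, P_s |- \/_k P_(s,k) over the children of
   s, and P_s |- Q for s in B.  An enumerable model makes the truth of P_s
   semidecidable uniformly in s, so that a path can be followed by searching for
   the least witness; the path meets B, hence Q holds.  By completeness Q has a
   derivation, which uses the axioms P_s |- Q for finitely many s only, and
   soundness in the structure given by an arbitrary path bounds the bar.

   (b) implies (a).  A model is chased along a path of the binary tree: states
   are finite lists of facts about finitely many constants, a step decomposes a
   fact (the bit of the path chooses a disjunct) or fires an axiom whose
   antecedent is already forced.  The limit along each path is an enumerable
   model, where the goal is true, hence forced at a finite stage; thus the
   decidable set of nodes forcing the goal is a bar.  A uniform bound turns the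
   finite tree of states into a derivation. *)

Require Import Defs.
From mathcomp Require Import all_boot.
From Stdlib Require Decidable StrictProp.
Set Implicit Arguments.
Unset Strict Implicit.
Unset Printing Implicit Defensive.

(** * Decidability and enumerations *)

Notation dec := Decidable.decidable.

Lemma dec_bool (b : bool) : dec b.
Proof. by case: b; [left | right]. Qed.

Lemma dec_eq (T : eqType) (x y : T) : dec (x = y).
Proof. by case: (eqVneq x y) => [|/eqP]; [left | right]. Qed.

Lemma dec_iff (P Q : Prop) : (P <-> Q) -> dec P -> dec Q.
Proof. by case=> pq qp [p|np]; [left; apply: pq | right=> /qp]. Qed.

(** No search is involved: [P] has at most one solution, and [Q] is tested there. Values of partial
    functions given as relations are handled in this way. *)
Lemma dec_ex_unique (X : Type) (P Q : X -> Prop) :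
  dec (exists x, P x) -> (forall x y, P x -> P y -> x = y) ->
  (forall x, P x -> dec (Q x)) -> dec (exists x, P x /\ Q x).
Proof.
case=> [[x Px]|nP] unP decQ; last by right=> -[x [Px _]]; apply: nP; exists x.
case: (decQ x Px) => [Qx|nQ]; first by left; exists x.
by right=> -[y [Py Qy]]; apply: nQ; rewrite (unP x y).
Qed.

Lemma dec_ltn_all (P : nat -> Prop) n :
  (forall i, i < n -> dec (P i)) -> dec (forall i, i < n -> P i).
Proof.
elim: n => [|n IHn] decP; first by left.
have [i lt_in|Pn|nPn] := IHn _; first by apply: decP; apply: ltnW.
- case: (decP n) => // [Pnn|nPnn]; last by right=> /(_ n (ltnSn n)).
  by left=> i; rewrite ltnS leq_eqVlt => /orP[/eqP->|/Pn].
- by right=> Pn; apply: nPn => i lt_in; apply: Pn; apply: ltnW.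
Qed.

Lemma dec_list_ex (X : Type) (P : X -> Prop) s :
  (forall x, List.In x s -> dec (P x)) -> dec (exists x, List.In x s /\ P x).
Proof.
elim: s => [|y s IHs] decP; first by right=> -[x [[]]].
have [x sx|[x [sx Px]]|nPs] := IHs _; first by apply: decP; right.
- by left; exists x; split=> //; right.
- case: (decP y) => [|Py|nPy]; first by left.
    by left; exists y; split=> //; left.
  by right=> -[x [/= [<-//|sx] Px]]; apply: nPs; exists x.
Qed.

Lemma dec_ltn_ex (P : nat -> Prop) n :
  (forall i, i < n -> dec (P i)) -> dec (exists i, i < n /\ P i).
Proof.
elim: n => [|n IHn] decP; first by right=> -[i []].
have [i lt_in|[i [lt_in Pi]]|nPn] := IHn _; first by apply: decP; apply: ltnW.
- by left; exists i; split=> //; apply: ltnW.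
- case: (decP n) => // [Pn|nPnn]; first by left; exists n.
  right=> -[i []]; rewrite ltnS leq_eqVlt => /orP[/eqP->//|lt_in Pi].
  by apply: nPn; exists i.
Qed.

(** Strong induction, a bounded search deciding whether a smaller witness exists. Together with
    [least_unique] this turns existence into unique existence, which takes the place of choice
    below. *)
Lemma ex_least (P : nat -> Prop) n :
  (forall i, dec (P i)) -> P n ->
  exists m, [/\ m <= n, P m & forall i, i < m -> ~ P i].
Proof.
move=> decP; elim/ltn_ind: n => n IHn Pn.
case: (@dec_ltn_all (fun i => ~ P i) n) => [i _|nP|].
- by apply: Decidable.dec_not; apply: decP.
- by exists n; split.
- move=> exP; case: (@dec_ltn_ex P n) => [i _|[i [lt_in Pi]]|nex].
  + exact: decP.
  + have [m [le_mi Pm min]] := IHn i lt_in Pi.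
    by exists m; split=> //; apply: leq_trans le_mi (ltnW lt_in).
  + by case: exP => i lt_in Pi; apply: nex; exists i.
Qed.

Lemma least_unique (P : nat -> Prop) m n :
  P m -> (forall i, i < m -> ~ P i) -> P n -> (forall i, i < n -> ~ P i) ->
  m = n.
Proof.
move=> Pm minm Pn minn.
by case: (ltngtP m n) => // [/minn|/minm].
Qed.

Section Listings.

Variables (X : Type) (P : X -> Prop).

(** The graph of a partial function from [nat] onto [P] with decidable domain. Partiality admits
    finite and empty sets. *)
Definition listing (L : nat -> X -> Prop) : Prop :=
  [/\ forall n x y, L n x -> L n y -> x = y,
      forall n, dec (exists x, L n x)
    & forall x, P x <-> exists n, L n x].

(** Dovetailing: an index codes the position of some [a] in the countable set and a candidate for
    the witness that [a] belongs to the semi-decidable subset. *)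
Lemma enumerable_listing : enumerable P -> exists L, listing L.
Proof.
case=> A [f [[K [_ Kf Ks]] decf [H [Hd Hf Hs]]]].
exists (fun n x => exists a mk,
  [/\ K a mk.1, unpickle n = Some mk, f a mk.2 & H x a]).
have Kinj a b m : K a m -> K b m -> a = b.
  by move=> Ka Kb; have [c [_ uc]] := Ks m I; rewrite -(uc a) // -(uc b).
have Hinj x y a : H x a -> H y a -> x = y.
  move=> Hx Hy; have [_ fa] := Hd _ _ Hx.
  by have [z [_ uz]] := Hs a fa; rewrite -(uz x) // -(uz y).
split.
- move=> n x y [a [mk [Ka Emk _ Hx]]] [b [mk' [Kb Emk' _ Hy]]].
  have Em : mk' = mk by apply: Some_inj; rewrite -Emk -Emk'.
  rewrite {}Em in Kb.
  by apply: Hinj Hx _; rewrite (Kinj _ _ _ Ka Kb).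
- move=> n; case En: (unpickle n) => [mk|]; last by right=> -[x [a [mk [_]]]].
  have [a [Ka _]] := Ks mk.1 I.
  case: (decf (a, mk.2) I) => /= [fa|nfa].
    have [|x [Hx _]] := Hs a; first by exists mk.2.
    by left; exists x, a, mk.
  right=> -[x [b [mk' [Kb Emk fb _]]]]; apply: nfa.
  by case: Emk => Em; rewrite Em (Kinj a b mk'.1) // -Em.
- move=> x; split=> [Px|[n [a [mk [_ _ _ /Hd[]]]]]//].
  have [a [Hx _]] := Hf x Px.
  have [_ [k fk]] := Hd _ _ Hx; have [m [Ka _]] := Kf a I.
  by exists (pickle (m, k)), a, (m, k); rewrite pickleK.
Qed.

(** Composing the two bijections embeds [P] into [nat], where equality is decidable. *)
Lemma enumerable_eq_dec x y : enumerable P -> P x -> P y -> dec (x = y).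
Proof.
case=> A [f [[K [_ Kf Ks]] _ [H [Hd Hf Hs]]]] Px Py.
have [a [Hx ua]] := Hf x Px; have [b [Hy _]] := Hf y Py.
have [m [Ka um]] := Kf a I; have [n [Kb _]] := Kf b I.
case: (eqVneq m n) => [Emn|nmn].
  left; have [c [_ uc]] := Ks n I.
  have Eab : a = b.
    by apply: etrans (esym (uc a _)) (uc b Kb); rewrite -Emn.
  have [z [_ uz]] := Hs b (proj2 (Hd _ _ Hy)).
  by apply: etrans (esym (uz x _)) (uz y Hy); rewrite -Eab.
right=> Exy; case/eqP: nmn; apply: um.
by rewrite (ua b) // Exy.
Qed.

Lemma countable_nat : countable nat.
Proof.
exists eq; split=> // [x _|y _]; first by exists x.
by exists y; split.
Qed.

(* The elements are indexed by their first occurrence in the listing. *)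
Lemma listing_enumerable L :
  (forall x y, P x -> P y -> dec (x = y)) -> listing L -> enumerable P.
Proof.
move=> decX [Lf Ld LP].
pose G (x : X) (a : nat) := L a x /\ forall b, b < a -> ~ L b x.
have decL a b x : L a x -> dec (L b x).
  move=> Lax; case: (Ld b) => [[y Lby]|nL]; last first.
    by right=> Lbx; apply: nL; exists x.
  have Pof n z : L n z -> P z by move=> Lnz; apply/LP; exists n.
  have [->|nxy] := decX x y (Pof _ _ Lax) (Pof _ _ Lby); first by left.
  by right=> Lbx; apply: nxy; apply: Lf Lbx Lby.
have decG x a : L a x -> dec (G x a).
  move=> Lax; apply: Decidable.dec_and; first by left.
  by apply: dec_ltn_all => b _; apply: Decidable.dec_not; apply: decL Lax.
(* The first occurrences form a decidable set of indices, so the semi-decision is constant in its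
   second argument. *)
exists nat, (fun a _ => exists x, G x a); split; first exact: countable_nat.
  case=> a n _ /=; case: (Ld a) => [[x Lax]|nL]; last first.
    by right=> -[x [Lax _]]; apply: nL; exists x.
  case: (decG x a Lax) => [Gxa|nG]; first by left; exists x.
  by right=> -[y Gya]; apply: nG; rewrite (Lf a x y) //; case: Gya.
exists G; split.
- by move=> x a Gxa; split; [apply/LP; exists a; case: Gxa | exists 0, x].
- move=> x /LP[n Lnx].
  have [|m [_ Lmx minm]] := @ex_least (fun i => L i x) n _ Lnx.
    by move=> i; apply: decL Lnx.
  exists m; split=> // m' [Lm' minm'].
  exact: (@least_unique (fun i => L i x)).
- move=> a [_ [x Gxa]]; exists x; split=> // y [Lay _].
  by apply: Lf Lay; case: Gxa.
Qed.

End Listings.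

(** * Substitution and soundness *)

Section Substitution.

Variable S : signature.

Lemma scons_ord0 (X : Type) n (x : X) (e : 'I_n -> X) : scons x e ord0 = x.
Proof. by rewrite /scons unlift_none. Qed.

Lemma scons_shift (X : Type) n (x : X) (e : 'I_n -> X) i :
  scons x e (shift i) = e i.
Proof. by rewrite /scons /shift liftK. Qed.

Lemma ord_shiftP n (P : 'I_n.+1 -> Prop) :
  P ord0 -> (forall i, P (shift i)) -> forall i, P i.
Proof. by move=> P0 PS i; case: (unliftP ord0 i) => [j|] -> //; apply: PS. Qed.

Lemma scons_eq (X : Type) n (x : X) (e e' : 'I_n -> X) :
  e =1 e' -> scons x e =1 scons x e'.
Proof.
by move=> ee'; apply: ord_shiftP => [|i]; rewrite ?scons_ord0 ?scons_shift.
Qed.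

Lemma up_comp k m n (r : 'I_k -> 'I_m) (r' : 'I_m -> 'I_n) :
  up r' \o up r =1 up (r' \o r).
Proof.
by apply: ord_shiftP => [|i]; rewrite /up /= ?scons_ord0 // !scons_shift.
Qed.

Lemma up_id n (r : 'I_n -> 'I_n) : r =1 id -> up r =1 id.
Proof.
by move=> rid; apply: ord_shiftP => [|i]; rewrite /up ?scons_ord0 // scons_shift rid.
Qed.

(** Stands in for function extensionality: renamings are compared pointwise throughout. *)
Lemma subst_ext m n (r r' : 'I_m -> 'I_n) (p : form S m) :
  r =1 r' -> subst r p = subst r' p.
Proof.
elim: p n r r' => //= {m}.
- by move=> m R args n r r' rr'; congr Rel; apply: val_inj; apply: eq_map.
- by move=> m i j n r r' rr'; rewrite !rr'.
- by move=> m p IHp q IHq n r r' rr'; rewrite (IHp _ _ _ rr') (IHq _ _ _ rr').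
- by move=> m p IHp q IHq n r r' rr'; rewrite (IHp _ _ _ rr') (IHq _ _ _ rr').
- by move=> m p IHp q IHq n r r' rr'; rewrite (IHp _ _ _ rr') (IHq _ _ _ rr').
- move=> m p IHp n r r' rr'; congr All; apply: IHp.
  by apply: scons_eq => i; rewrite rr'.
- move=> m p IHp n r r' rr'; congr Ex; apply: IHp.
  by apply: scons_eq => i; rewrite rr'.
Qed.

Lemma subst_comp k m n (r : 'I_k -> 'I_m) (r' : 'I_m -> 'I_n) (p : form S k) :
  subst r' (subst r p) = subst (r' \o r) p.
Proof.
elim: p m n r r' => //= {k}.
- by move=> k R args m n r r'; congr Rel; apply: val_inj; rewrite /= -map_comp.
- by move=> k p IHp q IHq m n r r'; rewrite IHp IHq.
- by move=> k p IHp q IHq m n r r'; rewrite IHp IHq.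
- by move=> k p IHp q IHq m n r r'; rewrite IHp IHq.
- by move=> k p IHp m n r r'; rewrite IHp (subst_ext _ (@up_comp _ _ _ r r')).
- by move=> k p IHp m n r r'; rewrite IHp (subst_ext _ (@up_comp _ _ _ r r')).
Qed.

Lemma subst_id n (r : 'I_n -> 'I_n) (p : form S n) : r =1 id -> subst r p = p.
Proof.
elim: p r => //= {n}.
- move=> n R args r rid; congr Rel; apply: val_inj.
  by rewrite /= (eq_map rid) map_id.
- by move=> n i j r rid; rewrite !rid.
- by move=> n p IHp q IHq r rid; rewrite IHp ?IHq.
- by move=> n p IHp q IHq r rid; rewrite IHp ?IHq.
- by move=> n p IHp q IHq r rid; rewrite IHp ?IHq.
- by move=> n p IHp r rid; rewrite IHp //; apply: up_id.
- by move=> n p IHp r rid; rewrite IHp //; apply: up_id.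
Qed.

Lemma inst_subst_up m n (r : 'I_m -> 'I_n) i (p : form S m.+1) :
  inst i (subst (up r) p) = subst (scons i r) p.
Proof.
rewrite /inst subst_comp; apply: subst_ext.
by apply: ord_shiftP => [|j]; rewrite /up /= ?scons_ord0 // !scons_shift.
Qed.

Variable D : diagram S.

Lemma drel_val R (u v : (arity R).-tuple (dom D)) :
  val u = val v -> drel D u <-> drel D v.
Proof. by move=> /val_inj ->. Qed.

Lemma sat_ext n (e e' : 'I_n -> dom D) (p : form S n) :
  e =1 e' -> sat e p <-> sat e' p.
Proof.
elim: p e e' => //= {n}.
- by move=> n R args e e' ee'; apply: drel_val; apply: eq_map.
- by move=> n i j e e' ee'; rewrite !ee'.
- by move=> n p IHp q IHq e e' ee'; rewrite (IHp _ _ ee') (IHq _ _ ee').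
- by move=> n p IHp q IHq e e' ee'; rewrite (IHp _ _ ee') (IHq _ _ ee').
- by move=> n p IHp q IHq e e' ee'; rewrite (IHp _ _ ee') (IHq _ _ ee').
- by move=> n p IHp e e' ee'; split=> H x; move: (H x);
    rewrite (IHp _ _ (scons_eq x ee')).
- by move=> n p IHp e e' ee'; split=> -[x H]; exists x; move: H;
    rewrite (IHp _ _ (scons_eq x ee')).
Qed.

Lemma scons_up (X : Type) m n (x : X) (r : 'I_m -> 'I_n) (e : 'I_n -> X) :
  scons x e \o up r =1 scons x (e \o r).
Proof.
by apply: ord_shiftP => [|i]; rewrite /up /= ?scons_ord0 // !scons_shift.
Qed.

Lemma sat_subst m n (r : 'I_m -> 'I_n) (e : 'I_n -> dom D) (p : form S m) :
  sat e (subst r p) <-> sat (e \o r) p.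
Proof.
elim: p n r e => //= {m}.
- move=> m R args n r e; by apply: drel_val; rewrite /= -map_comp.
- by move=> m p IHp q IHq n r e; rewrite IHp IHq.
- by move=> m p IHp q IHq n r e; rewrite IHp IHq.
- by move=> m p IHp q IHq n r e; rewrite IHp IHq.
- by move=> m p IHp n r e; split=> H x; move: (H x);
    rewrite IHp (sat_ext _ (scons_up x r e)).
- by move=> m p IHp n r e; split=> -[x H]; exists x; move: H;
    rewrite IHp (sat_ext _ (scons_up x r e)).
Qed.

Lemma sat_shift n (x : dom D) (e : 'I_n -> dom D) (p : form S n) :
  sat (scons x e) (subst shift p) <-> sat e p.
Proof.
rewrite sat_subst; apply: sat_ext => i; exact: scons_shift.
Qed.

Lemma sat_inst n (i : 'I_n) (e : 'I_n -> dom D) (p : form S n.+1) :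
  sat e (inst i p) <-> sat (scons (e i) e) p.
Proof.
rewrite sat_subst; apply: sat_ext.
by apply: ord_shiftP => [|j]; rewrite /= ?scons_ord0 ?scons_shift.
Qed.

Lemma sat_deq n (e e' : 'I_n -> dom D) (p : form S n) :
  (forall i, deq D (e i) (e' i)) -> sat e p -> sat e' p.
Proof.
have scons_deq k (f f' : 'I_k -> dom D) x :
    (forall i, deq D (f i) (f' i)) ->
    forall i, deq D (scons x f i) (scons x f' i).
  move=> ff'; apply: ord_shiftP => [|i]; rewrite ?scons_ord0 ?scons_shift //.
  exact: deq_refl.
(* Implication is contravariant on the left, so the induction also needs the reversed equalities. *)
have sym k (f f' : 'I_k -> dom D) :
    (forall i, deq D (f i) (f' i)) -> forall i, deq D (f' i) (f i).
  by move=> ff' i; apply: deq_sym.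
elim: p e e' => //= {n}.
- move=> n R args e e' ee'; apply: drel_congr => i.
  by rewrite !tnth_map.
- move=> n i j e e' ee' ij.
  by apply: deq_trans (ee' j); apply: deq_trans ij; apply: deq_sym.
- by move=> n p IHp q IHq e e' ee' [/(IHp _ _ ee') ? /(IHq _ _ ee')].
- by move=> n p IHp q IHq e e' ee' [/(IHp _ _ ee')|/(IHq _ _ ee')]; [left|right].
- move=> n p IHp q IHq e e' ee' pq.
  by move=> /(IHp _ _ (sym _ _ _ ee'))/pq/(IHq _ _ ee').
- by move=> n p IHp e e' ee' H x; apply: IHp (H x); apply: scons_deq.
- by move=> n p IHp e e' ee' [x H]; exists x; apply: IHp H; apply: scons_deq.
Qed.

(** Empty domains are allowed: [d_AllE], [d_ExI] and [d_EqI] pick a variable of the context, which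
    [e] interprets. *)
Lemma soundness (T : theory S) n (G : seq (form S n)) p :
  model_diagram T D -> deriv T G p ->
  forall e : 'I_n -> dom D, (forall q, List.In q G -> sat e q) -> sat e p.
Proof.
move=> modT; elim=> {n G p} //=.
- move=> n G m p q r Tpq _ IH e eG; rewrite sat_subst.
  by apply: (modT _ Tpq); rewrite -sat_subst; apply: IH.
- by move=> n G p Gp e; apply.
- by move=> n G p _ IH e /IH.
- by move=> n G p q _ IHp _ IHq e eG; split; [apply: IHp | apply: IHq].
- by move=> n G p q _ IH e /IH[].
- by move=> n G p q _ IH e /IH[].
- by move=> n G p q _ IH e /IH; left.
- by move=> n G p q _ IH e /IH; right.
- move=> n G p q c _ IH _ IHp _ IHq e eG.
  by case: (IH e eG) => H; [apply: IHp | apply: IHq] => s [<-//|/eG].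
- by move=> n G p q _ IH e eG H; apply: IH => s [<-//|/eG].
- by move=> n G p q _ IHpq _ IHp e eG; apply: IHpq => //; apply: IHp.
- move=> n G p _ IH e eG x; apply: IH => q /List.in_map_iff[s [<- /eG]].
  by rewrite sat_shift.
- by move=> n G p i _ IH e eG; rewrite sat_inst; apply: IH.
- by move=> n G p i _ IH e eG; exists (e i); rewrite -sat_inst; apply: IH.
- move=> n G p c _ IH _ IHc e eG; have [x px] := IH e eG.
  rewrite -(sat_shift x); apply: IHc => q [<-//|/List.in_map_iff[s [<- /eG]]].
  by rewrite sat_shift.
- by move=> n G i e _; apply: deq_refl.
- move=> n G p i j _ IHij _ IHp e eG.
  have := IHp e eG; rewrite !sat_inst; apply: sat_deq.
  apply: ord_shiftP => [|k]; rewrite ?scons_ord0 ?scons_shift; first exact: IHij.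
  exact: deq_refl.
Qed.

End Substitution.

(** Finitely many axioms occur in a derivation; the premises of a rule are moved to the maximum of
    their stages. *)
Lemma deriv_compact (S : signature) (T : theory S) (U : nat -> theory S)
    n (G : seq (form S n)) p :
  (forall s, T s -> exists m, U m s) ->
  (forall m k s, m <= k -> U m s -> U k s) ->
  deriv T G p -> exists m, deriv (U m) G p.
Proof.
move=> TU mono.
have mono_deriv m k l (H : seq (form S l)) q :
    m <= k -> deriv (U m) H q -> deriv (U k) H q.
  move=> le_mk; elim=> {l H q}; by intros; econstructor; eauto.
elim=> {n G p}.
- move=> n G m p q r /TU[a Upq] _ [b IH]; exists (maxn a b).
  apply: (d_Ax (mono _ _ _ (leq_maxl a b) Upq)).
  exact: mono_deriv (leq_maxr a b) IH.
- by move=> n G p Gp; exists 0; apply: d_Hyp.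
- by move=> n G; exists 0; apply: d_TopI.
- by move=> n G p _ [m IH]; exists m; apply: d_BotE.
- move=> n G p q _ [a IHp] _ [b IHq]; exists (maxn a b); apply: d_AndI.
    exact: mono_deriv (leq_maxl a b) IHp.
  exact: mono_deriv (leq_maxr a b) IHq.
- by move=> n G p q _ [m IH]; exists m; apply: d_AndEl IH.
- by move=> n G p q _ [m IH]; exists m; apply: d_AndEr IH.
- by move=> n G p q _ [m IH]; exists m; apply: d_OrIl.
- by move=> n G p q _ [m IH]; exists m; apply: d_OrIr.
- move=> n G p q c _ [a IH] _ [b IHp] _ [d IHq].
  exists (maxn a (maxn b d)).
  by apply: d_OrE;
    [apply: mono_deriv IH | apply: mono_deriv IHp | apply: mono_deriv IHq];
    rewrite !leq_max leqnn ?orbT.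
- by move=> n G p q _ [m IH]; exists m; apply: d_ImpI.
- move=> n G p q _ [a IHpq] _ [b IHp]; exists (maxn a b).
  apply: d_ImpE (mono_deriv _ _ _ _ _ (leq_maxl a b) IHpq) _.
  exact: mono_deriv (leq_maxr a b) IHp.
- by move=> n G p _ [m IH]; exists m; apply: d_AllI.
- by move=> n G p i _ [m IH]; exists m; apply: d_AllE.
- by move=> n G p i _ [m IH]; exists m; apply: d_ExI IH.
- move=> n G p c _ [a IH] _ [b IHc]; exists (maxn a b).
  apply: d_ExE (mono_deriv _ _ _ _ _ (leq_maxl a b) IH) _.
  exact: mono_deriv (leq_maxr a b) IHc.
- by move=> n G i; exists 0; apply: d_EqI.
- move=> n G p i j _ [a IH] _ [b IHp]; exists (maxn a b).
  apply: d_EqE (mono_deriv _ _ _ _ _ (leq_maxl a b) IH) _.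
  exact: mono_deriv (leq_maxr a b) IHp.
Qed.

(** * Completeness implies the fan theorem *)

(** A code has at most one preimage, and [pickle_inv] computes it. *)
Lemma dec_pickle (T : countType) (P : T -> Prop) n :
  (forall x, dec (P x)) -> dec (exists x, pickle x = n /\ P x).
Proof.
move=> decP; case En: (@pickle_inv T n) => [x|].
  have Ex : pickle x = n by have := @pickle_invK T n; rewrite En.
  case: (decP x) => [Px|nPx]; first by left; exists x.
  right=> -[y [Ey Py]]; apply: nPx.
  by rewrite (pcan_inj (@pickleK T) (etrans Ex (esym Ey))).
by right=> -[x [Ex _]]; rewrite -Ex pickleK_inv in En.
Qed.

Lemma initial_segment_rcons alpha s k :
  initial_segment alpha (rcons s k) <->
  initial_segment alpha s /\ alpha (size s) k.
Proof.
split=> [init|[init ak] i].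
  split=> [i lt_is|]; last first.
    by have := init (size s); rewrite size_rcons nth_rcons ltnn eqxx; apply.
  by have := init i; rewrite size_rcons nth_rcons lt_is; apply; apply: leqW.
rewrite size_rcons ltnS nth_rcons leq_eqVlt.
case: (ltngtP i (size s)) => //= [lt_is _|-> _//].
exact: init.
Qed.

Lemma initial_segment_exists alpha n :
  (forall i, exists! k, alpha i k) ->
  exists s, initial_segment alpha s /\ size s = n.
Proof.
move=> fun_alpha; elim: n => [|n [s [init <-]]]; first by exists [::].
have [k [ak _]] := fun_alpha (size s); exists (rcons s k).
by rewrite size_rcons initial_segment_rcons.
Qed.

Lemma initial_segment_unique alpha s t :
  (forall i, exists! k, alpha i k) ->
  initial_segment alpha s -> initial_segment alpha t -> size s = size t -> s = t.
Proof.
move=> fun_alpha inits initt Est; apply: (@eq_from_nth _ 0) => // i lt_is.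
have [k [_ uk]] := fun_alpha i.
by rewrite -(uk _ (inits i lt_is)) -(uk _ (initt i _)) // -Est.
Qed.

(* No choice is used: among the witnesses of the possible continuations, the
   one with the least code is followed. *)
Lemma path_of_semidecidable (F P : seq nat -> Prop)
    (g : seq nat -> seq nat -> Prop) :
  (forall s, dec (F s)) -> (forall s w, dec (g s w)) ->
  (forall s, P s <-> exists w, g s w) ->
  F [::] -> P [::] ->
  (forall s, F s -> P s -> exists k, F (rcons s k) /\ P (rcons s k)) ->
  exists alpha, path_in F alpha /\ forall s, initial_segment alpha s -> P s.
Proof.
move=> decF decg gP F0 P0 FP.
pose Q s j := exists kw : nat * seq nat,
  pickle kw = j /\ (F (rcons s kw.1) /\ g (rcons s kw.1) kw.2).
have decQ s j : dec (Q s j).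
  by apply: dec_pickle => kw; apply: Decidable.dec_and.
pose nxt (s : seq nat) (k : nat) := exists w : seq nat,
  Q s (pickle (k, w)) /\ forall i, i < pickle (k, w) -> ~ Q s i.
have nxt_ex s : F s -> P s -> exists k, nxt s k.
  move=> Fs Ps; have [k [Fk /gP[w gw]]] := FP s Fs Ps.
  have [||j [_ [[k' w'] [<- Qj]] minj]] := @ex_least (Q s) (pickle (k, w)).
  - exact: decQ.
  - by exists (k, w).
  by exists k', w'; split=> //; exists (k', w').
have nxt_unique s k k' : nxt s k -> nxt s k' -> k = k'.
  move=> [w [Qw minw]] [w' [Qw' minw']].
  have /(pcan_inj (@pickleK _))[] // := least_unique Qw minw Qw' minw'.
have nxt_FP s k : nxt s k -> F (rcons s k) /\ P (rcons s k).
  move=> [w [[kw [/(pcan_inj (@pickleK _))-> [Fk gk]]] _]].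
  by split=> //; apply/gP; exists w.
(* The graph of the map from [n] to the first [n] values of the path. It is defined by recursion on
   relations because [nxt] is not a function; the next lemmas show that it is total and
   single-valued. *)
pose reach := fix reach n s := match n with
  | 0 => s = [::]
  | n'.+1 => exists s' k, [/\ reach n' s', nxt s' k & s = rcons s' k]
  end.
have reach_FP n s : reach n s -> F s /\ P s.
  case: n => [->//|n [s' [k [_ /nxt_FP FPk ->]]]].
  exact: FPk.
have reach_size n s : reach n s -> size s = n.
  elim: n s => [s ->//|n IHn s [s' [k [/IHn <- _ ->]]]].
  by rewrite size_rcons.
have reach_unique n s t : reach n s -> reach n t -> s = t.
  elim: n s t => [s t -> ->//|n IHn s t [s' [k [rs ns ->]]] [t' [l [rt nt ->]]]].
  by move: ns; rewrite (IHn _ _ rs rt) => ns; rewrite (nxt_unique _ _ _ ns nt).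
have reach_ex n : exists s, reach n s.
  elim: n => [|n [s rs]]; first by exists [::].
  have [Fs Ps] := reach_FP _ _ rs; have [k nk] := nxt_ex s Fs Ps.
  by exists (rcons s k), s, k.
pose alpha i k := exists s, reach i s /\ nxt s k.
have init_reach s : initial_segment alpha s -> reach (size s) s.
  elim/last_ind: s => // s k IHs /initial_segment_rcons[/IHs rs [t [rt nk]]].
  rewrite size_rcons; exists s, k; split=> //.
  by rewrite (reach_unique _ _ _ rs rt).
exists alpha; split; last by move=> s /init_reach/reach_FP[].
split=> [i|s /init_reach/reach_FP[]//].
have [s rs] := reach_ex i; have [Fs Ps] := reach_FP _ _ rs.
have [k nk] := nxt_ex s Fs Ps; exists k; split; first by exists s.
move=> l [t [rt nl]]; apply: nxt_unique nk _.
by rewrite (reach_unique _ _ _ rs rt).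
Qed.

(* [true] is the edge relation and [false] relates a root to marked nodes. *)
Definition chain_sig : signature := @Signature bool (fun=> 2).

Fixpoint chain n {m} (cur root : 'I_m) : form chain_sig m :=
  match n with
  | 0 => @Rel chain_sig m false [tuple root; cur]
  | n'.+1 => Ex (And (@Rel chain_sig _ true [tuple shift cur; ord0])
                     (chain n' ord0 (shift root)))
  end.

(* A proposition variable with index [n]: the node at distance [n] from some
   root is marked.  A signature with infinitely many nullary symbols would not
   do, since the enumerations of their interpretations in an enumerable diagram
   could only be collected by countable choice. *)
Definition mark n {m} : form chain_sig m := Ex (chain n ord0 ord0).

Lemma chain_pc n m (i j : 'I_m) : positive_coherent (chain n i j).
Proof. by elim: n m i j => //= n IHn m i j; apply: IHn. Qed.

(** * Semidecidability of marks in enumerable diagrams *)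

Section SemidecidableMarks.

Variables (D : diagram chain_sig) (L : nat -> dom D -> Prop).
Variable LR : bool -> nat -> 2.-tuple (dom D) -> Prop.
Hypothesis decD : forall x y : dom D, dec (x = y).
Hypothesis LP : listing (@full (dom D)) L.
Hypothesis LRP : forall R, listing (@drel chain_sig D R) (LR R).

(** The list [w] consists of positions in the listings only. A position determines the endpoint [y]
    of its edge, so the check stays decidable in spite of the quantifier over [y]. *)
Fixpoint chain_witness n (x root : dom D) (w : seq nat) : Prop :=
  match n, w with
  | 0, [:: m] => LR false m [tuple root; x]
  | n'.+1, m :: w' =>
    exists y, LR true m [tuple x; y] /\ chain_witness n' y root w'
  | _, _ => False
  end.

Lemma dec_LR R m x y : dec (LR R m [tuple x; y]).
Proof.
have [LRf LRd _] := LRP R; case: (LRd m) => [[u]|nL]; last first.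
  by right=> Lxy; apply: nL; exists [tuple x; y].
case/tupleP: u => a u; case/tupleP: u => b u; rewrite (tuple0 u) => Lab.
case: (decD x a) => [Exa|nxa]; last by right=> Lxy; case: (LRf _ _ _ Lab Lxy) => /esym.
case: (decD y b) => [Eyb|nyb]; last by right=> Lxy; case: (LRf _ _ _ Lab Lxy) => _ /esym.
left; rewrite Exa Eyb; congr (LR R m _): Lab; exact: val_inj.
Qed.

Lemma dec_ex_LR R m x : dec (exists y, LR R m [tuple x; y]).
Proof.
have [LRf LRd _] := LRP R; case: (LRd m) => [[u]|nL]; last first.
  by right=> -[y Lxy]; apply: nL; exists [tuple x; y].
case/tupleP: u => a u; case/tupleP: u => b u; rewrite (tuple0 u) => Lab.
case: (dec_LR R m x b) => [Lxb|nL]; first by left; exists b.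
right=> -[y Lxy]; apply: nL.
by case: (LRf _ _ _ Lab Lxy) => Ea Eb; rewrite Eb.
Qed.

Lemma dec_chain_witness n x root w : dec (chain_witness n x root w).
Proof.
elim: n x w => [|n IHn] x [|m w] /=; try by right.
  by case: w => [|m' w]; [apply: dec_LR | right].
apply: dec_ex_unique (dec_ex_LR true m x) _ _ => // y z Ly Lz.
by have [LRf _ _] := LRP true; case: (LRf _ _ _ Ly Lz).
Qed.

Lemma chain_witnessP n m (e : 'I_m -> dom D) i j :
  sat e (chain n i j) <-> exists w, chain_witness n (e i) (e j) w.
Proof.
have LR2 R (u : 2.-tuple _) x y :
    val u = [:: x; y] -> @drel _ D R u <-> exists k, LR R k [tuple x; y].
  move=> Eu; have [_ _ ->] := LRP R.
  by rewrite (_ : u = [tuple x; y]) //; apply: val_inj.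
elim: n m e i j => [|n IHn] m e i j /=.
  rewrite (LR2 false _ (e j) (e i)) //.
  by split=> [[k Lk]|[[|k [|? ?]]//= Lk]]; [exists [:: k] | exists k].
split=> [[y [/(LR2 true _ (e i) y)]]|[[|k w]//= [y [Lk wit]]]].
  rewrite /= ?scons_ord0 !scons_shift => -[//|k Lk] /IHn[w].
  by rewrite scons_ord0 scons_shift => wit; exists (k :: w), y.
exists y; split; last by apply/IHn; exists w; rewrite scons_ord0 scons_shift.
by apply/(LR2 true _ (e i) y); [rewrite /= scons_ord0 scons_shift | exists k].
Qed.

Definition mark_witness n (w : seq nat) : Prop :=
  if w is k :: w' then exists x, L k x /\ chain_witness n x x w' else False.

Lemma dec_mark_witness n w : dec (mark_witness n w).
Proof.
case: w => [|k w] /=; first by right.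
have [Lf Ld _] := LP; apply: dec_ex_unique (Ld k) _ _; first exact: Lf.
by move=> x _; apply: dec_chain_witness.
Qed.

Lemma mark_witnessP n m (e : 'I_m -> dom D) :
  sat e (mark n) <-> exists w, mark_witness n w.
Proof.
have [_ _ LE] := LP; split=> [[x /chain_witnessP[w]]|[[|k w]//= [x [_ wit]]]].
  have [k Lk] := proj1 (LE x) I.
  by rewrite scons_ord0 => wit; exists (k :: w), x.
by exists x; apply/chain_witnessP; exists w; rewrite scons_ord0.
Qed.

End SemidecidableMarks.

(** One [g] serves for all [n], since just three listings are obtained: of the domain and of the two
    relations. *)
Lemma marks_semidecidable (D : diagram chain_sig) :
  enumerable_diagram D ->
  exists g : nat -> seq nat -> Prop, (forall n w, dec (g n w)) /\
    forall n m (e : 'I_m -> dom D), sat e (mark n) <-> exists w, g n w.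
Proof.
move=> [enumD _ enumR]; have [L LP] := enumerable_listing enumD.
have [LE LEP] := enumerable_listing (enumR true).
have [LM LMP] := enumerable_listing (enumR false).
pose LR (R : bool) := if R then LE else LM.
have LRP R : listing (@drel _ D R) (LR R) by case: R.
have decD x y : dec (x = y :> dom D) by apply: enumerable_eq_dec enumD _ _.
exists (@mark_witness D L LR); split=> [n w|n m e].
  exact: dec_mark_witness.
exact: mark_witnessP.
Qed.

(** Edges go from a number to its successor and [0] is the only root, so the proposition variable
    with index [n] can be given an arbitrary truth value [M n]. *)
Definition nat_diagram (M : nat -> Prop) : diagram chain_sig.
Proof.
refine (@Diagram chain_sig nat eq (fun R u =>
  if R then nth 0 u 1 = (nth 0 u 0).+1 else nth 0 u 0 = 0 /\ M (nth 0 u 1))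
  (@erefl _) (@esym _) (@etrans _) _).
by move=> R u v uv; rewrite (_ : u = v) //; apply: eq_from_tnth.
Defined.

Lemma sat_mark_nat M n m (e : 'I_m -> dom (nat_diagram M)) :
  sat e (mark n) <-> M n.
Proof.
have satc k l (e' : 'I_l -> dom (nat_diagram M)) i j :
    sat e' (chain k i j) <-> e' j = 0 /\ M (e' i + k).
  elim: k l e' i j => [|k IHk] l e' i j /=; first by rewrite addn0.
  split=> [[y []]|[Ej Mi]].
    rewrite /= scons_ord0 scons_shift => -> /IHk.
    by rewrite scons_ord0 scons_shift addSnnS.
  exists (e' i).+1; rewrite /= scons_ord0 scons_shift; split=> //.
  by apply/IHk; rewrite scons_ord0 scons_shift addSnnS.
split=> [[x /satc]|Mn]; first by rewrite scons_ord0 => -[->].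
by exists 0; apply/satc; rewrite scons_ord0.
Qed.

(** * The theory of a decidable bar in a fan *)

Section BarTheory.

Variables F B : seq nat -> Prop.

(* [node_form (Some s)] says that the path runs through [s], and
   [node_form None] that the bar has been hit. *)
Definition node_form (o : option (seq nat)) {m} : form chain_sig m :=
  mark (pickle o).

(** Indices of the three kinds of axioms: root, branching, bar. A branching index carries a list of
    the children, so none has to be chosen for each node. *)
Definition bar_index : Type := option (seq nat * seq nat + seq nat).

Definition valid_index (i : bar_index) : Prop :=
  match i with
  | None => True
  | Some (inl (s, ks)) => F s /\ forall k, F (rcons s k) <-> k \in ks
  | Some (inr s) => F s /\ B s
  end.

(** Since [Bot] is not positive, the disjunction ends in a repetition of its first disjunct; the
    children of a node of a spread are never empty. *)
Definition children_form m s ks : form chain_sig m :=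
  foldr (fun k => Or (node_form (Some (rcons s k))))
        (node_form (Some (rcons s (head 0 ks)))) ks.

(* The context has no variable occurring in the formulas: it only serves to
   make the axioms pairwise distinct. *)
Definition bar_axiom (i : bar_index) : sequent chain_sig :=
  Sequent (context := if i is Some j then (pickle j).+1 else 0)
    match i with
    | None => Top
    | Some (inl (s, _)) => node_form (Some s)
    | Some (inr s) => node_form (Some s)
    end
    match i with
    | None => node_form (Some [::])
    | Some (inl (s, ks)) => children_form _ s ks
    | Some (inr s) => node_form None
    end.

Definition bar_theory (t : sequent chain_sig) : Prop :=
  exists i, valid_index i /\ bar_axiom i = t.

(** Only the bar axioms are cut off, so that [m] becomes the uniform bound. *)
Definition bar_theory_upto m (t : sequent chain_sig) : Prop :=
  exists i, [/\ valid_index i, bar_axiom i = t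
              & if i is Some (inr s) then size s <= m else true].

Lemma bar_axiom_inj : injective bar_axiom.
Proof.
move=> i j /(congr1 (@context _)) /=; case: i j => [i|] [j|] //= [].
by move=> /(pcan_inj (@pickleK _)) ->.
Qed.

Lemma children_form_pc m s ks : positive_coherent (children_form m s ks).
Proof.
rewrite /children_form; elim: ks (head 0 ks) => [|k ks IHks] k0 /=.
  exact: chain_pc.
by rewrite chain_pc; apply: IHks.
Qed.

Lemma bar_theory_pc : positive_coherent_theory bar_theory.
Proof.
move=> _ [i [_ <-]]; case: i => [[[s ks]|s]|];
  rewrite /positive_coherent_sequent /= ?chain_pc //.
exact: children_form_pc.
Qed.

Lemma sat_children (D : diagram chain_sig) m (e : 'I_m -> dom D) s ks :
  ks != [::] ->
  sat e (children_form m s ks) <->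
  exists k, k \in ks /\ sat e (node_form (Some (rcons s k))).
Proof.
have sat_fold l k0 :
    sat e (foldr (fun k => Or (node_form (Some (rcons s k))))
                 (node_form (Some (rcons s k0))) l) <->
    exists k, k \in k0 :: l /\ sat e (node_form (Some (rcons s k))).
  elim: l => [|k1 l IHl].
    by split=> [sk|[k []]]; [exists k0; rewrite mem_head | rewrite inE => /eqP->].
  split=> [[sk1|/IHl[k [kl sk]]]|[k [kl sk]]].
  - by exists k1; rewrite !inE eqxx orbT.
  - by exists k; move: kl; rewrite !inE => /orP[]->; rewrite ?orbT.
  - move: kl; rewrite !inE orbCA => /orP[/eqP<-|kl]; first by left.
    by right; apply/IHl; exists k; rewrite inE.
case: ks => // k0 ks _; rewrite /children_form sat_fold.
by split=> -[k [kl sk]]; exists k; move: kl; rewrite !inE orbA orbb.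
Qed.

Hypothesis fanF : fan F.
Hypothesis decB : decidable_on F B.

Lemma dec_F s : dec (F s).
Proof. by have [[decF _ _] _] := fanF; apply: decF. Qed.

Lemma dec_valid_index i : dec (valid_index i).
Proof.
case: i => [[[s ks]|s]|] /=; last by left.
- case: (dec_F s) => [Fs|nFs]; last by right=> -[].
  have [b leb] := fanF.2 s Fs.
  (* The fan bound [b] reduces the quantifier over all children to a bounded one. *)
  have decb : dec (forall k, k < b.+1 -> F (rcons s k) -> k \in ks).
    apply: dec_ltn_all => k _; apply: Decidable.dec_imp; first exact: dec_F.
    exact: dec_bool.
  have deck : dec (forall i, i < size ks -> F (rcons s (nth 0 ks i))).
    by apply: dec_ltn_all => i _; apply: dec_F.
  apply: dec_iff (Decidable.dec_and _ _ decb deck).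
  split=> [[leks ksF]|[_ Fks]].
    split=> // k; split=> [Fk|/(nthP 0)[i lt_i <-]]; last exact: ksF.
    by apply: leks => //; apply: leb.
  by split=> [k _ /Fks|i /(mem_nth 0)/Fks].
- case: (dec_F s) => [Fs|nFs]; last by right=> -[].
  by case: (decB Fs) => [Bs|nBs]; [left | right=> -[]].
Qed.

Lemma valid_children s : F s -> exists ks, valid_index (Some (inl (s, ks))).
Proof.
move=> Fs; have [b leb] := fanF.2 s Fs.
suff [ks ksP] : exists ks : seq nat, forall k, k \in ks <-> k < b.+1 /\ F (rcons s k).
  exists ks; split=> // k; split=> [Fk|/ksP[]//].
  by apply/ksP; split=> //; apply: leb.
elim: b.+1 => [|n [ks IHks]]; first by exists [::] => k; split=> // -[].
case: (dec_F (rcons s n)) => [Fn|nFn].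
  exists (n :: ks) => k; rewrite inE ltnS leq_eqVlt.
  split=> [/orP[/eqP->|/IHks[-> ?]]|[/orP[/eqP->|lt_kn] Fk]]; rewrite ?eqxx ?orbT //.
  by apply/orP; right; apply/IHks.
exists ks => k; split=> [/IHks[lt_kn Fk]|[]]; first by split=> //; apply: ltnW.
by rewrite ltnS leq_eqVlt => /orP[/eqP->//|lt_kn Fk]; apply/IHks.
Qed.

Lemma bar_theory_enumerable : enumerable_theory bar_theory.
Proof.
split.
  apply: (@listing_enumerable _ _ (fun n b => n = nat_of_bool b)).
    by move=> x y _ _ /=; apply: dec_iff (dec_bool (x == y :> bool)); split=> /eqP.
  split=> [n [] [] -> //|[|[|n]]|b]; first by left; exists false.
  - by left; exists true.
  - by right=> -[[]].
  - by split=> // _; exists b.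
apply: (@listing_enumerable (sequent chain_sig) bar_theory (fun n t =>
  exists i : bar_index, pickle i = n /\ (valid_index i /\ bar_axiom i = t))).
  (* Equality of axioms is decided on their indices, by [bar_axiom_inj]. *)
  move=> _ _ [i [_ <-]] [j [_ <-]].
  by apply: dec_iff (dec_bool (i == j)); split=> [/eqP->|/bar_axiom_inj->].
split.
- by move=> n x y [i [<- [_ <-]]] [j [/(pcan_inj (@pickleK _))-> [_ <-]]].
- move=> n; apply: dec_iff (dec_pickle n dec_valid_index).
  split=> [[i [Ei Vi]]|[t [i [Ei [Vi _]]]]]; last by exists i.
  by exists (bar_axiom i), i.
- by move=> t; split=> [[i Hi]|[n [i [_ Hi]]]]; [exists (pickle i), i | exists i].
Qed.

Lemma bar_theory_complete_models (D : diagram chain_sig) :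
  bar F B -> enumerable_diagram D -> model_diagram bar_theory D ->
  true_in D (@Sequent chain_sig 0 Top (node_form None)).
Proof.
move=> barB enumD modD e _ /=.
have [g [decg gP]] := marks_semidecidable enumD.
have root : sat e (node_form (Some [::])).
  by have := modD (bar_axiom None) (ex_intro _ None (conj I erefl)); apply.
(* The root axiom is existential, so the domain is inhabited; [x0] fills the dummy contexts of the
   other axioms. *)
have [x0 _] := root.
have modE i (Vi : valid_index i) := modD _ (ex_intro _ i (conj Vi erefl)) (fun=> x0).
have satE o m (e' : 'I_m -> dom D) : sat e (node_form o) <-> sat e' (node_form o).
  by rewrite !gP.
have [[decF F0 Fchild] _] := fanF.
pose P s := sat e (node_form (Some s)).
have [|||||s|alpha [path_alpha Palpha]] :=
  @path_of_semidecidable F P (fun s => g (pickle (Some s))).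
- exact: dec_F.
- by move=> s w; apply: decg.
- by move=> s; apply: gP.
- exact: F0.
- exact: root.
- move=> Fs Ps; have [ks Vks] := valid_children Fs.
  have := modE _ Vks; rewrite /= sat_children.
    case; first by apply/satE.
    move=> k [k_ks sk]; exists k; split; first by apply/Vks.2.
    exact: (proj2 (satE _ _ _)) sk.
  have [k /Vks.2] := proj1 (Fchild s) Fs.
  by case: (ks).
have [s [init_s Bs]] := barB alpha path_alpha.
have Vs : valid_index (Some (inr s)) by split=> //; apply: path_alpha.2.
apply: (proj2 (satE _ _ _)) (modE _ Vs _).
exact: (proj1 (satE _ _ _)) (Palpha s init_s).
Qed.

Lemma uniform_bar_of_provable :
  provable bar_theory (@Sequent chain_sig 0 Top (node_form None)) ->
  uniform_bar F B.
Proof.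
move=> prov; have [| |m prov_m] := deriv_compact (U := bar_theory_upto) _ _ prov.
- move=> t [i [Vi Ei]]; exists (if i is Some (inr s) then size s else 0), i.
  by split=> //; case: i Vi Ei => [[]|].
- move=> m k t le_mk [i [Vi Ei le_m]]; exists i; split=> //.
  by case: i le_m {Vi Ei} => [[]|] // s /leq_trans; apply.
exists m => alpha [fun_alpha Falpha].
(* The node [Some s] is read as [alpha] running through [s], and [None] as the desired conclusion
   about [alpha]. *)
pose M n := exists o : option (seq nat), pickle o = n /\
  if o is Some s then initial_segment alpha s
  else exists s, [/\ initial_segment alpha s, size s <= m & B s].
have satM o k (e : 'I_k -> dom (nat_diagram M)) : sat e (node_form o) <->
    if o is Some s then initial_segment alpha s
    else exists s, [/\ initial_segment alpha s, size s <= m & B s].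
  rewrite sat_mark_nat; split=> [[o' [/(pcan_inj (@pickleK _))->]]//|Ho].
  by exists o.
have modM : model_diagram (bar_theory_upto m) (nat_diagram M).
  move=> _ [[[[s ks]|s]|] [Vi <- le_m]] e //=.
  - move=> /(satM (Some s)) init_s; have [Fs Fks] := Vi.
    have [k [ak _]] := fun_alpha (size s).
    have init_k : initial_segment alpha (rcons s k) by apply/initial_segment_rcons.
    have k_ks : k \in ks by apply/Fks/Falpha.
    apply/sat_children; first by case: (ks) k_ks.
    by exists k; split=> //; apply/(satM (Some _)).
  - move=> /(satM (Some s)) init_s; apply/(satM None).
    by exists s; split=> //; case: Vi.
  - by move=> _; apply/(satM (Some [::])).
apply/(satM None 0 (fun=> 0)).
by apply: (soundness modM prov_m) => q [<-|[]].
Qed.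

End BarTheory.

Lemma fan_of_completeness : enumerable_completeness -> FAN_D.
Proof.
move=> compl F B fanF decB barB; apply: uniform_bar_of_provable.
apply: compl.
- exact: bar_theory_pc.
- exact: bar_theory_enumerable.
- by [].
- by move=> D; apply: bar_theory_complete_models.
Qed.

(** * The fan theorem implies completeness *)

Lemma deriv_eq_sym S (T : theory S) n (G : seq (form S n)) i j :
  deriv T G (Eq i j) -> deriv T G (Eq j i).
Proof.
move=> Gij; have := d_EqE (p := Eq ord0 (shift i)) Gij.
by rewrite /inst /= !scons_ord0 !scons_shift; apply; apply: d_EqI.
Qed.

Lemma deriv_eq_trans S (T : theory S) n (G : seq (form S n)) i j k :
  deriv T G (Eq i j) -> deriv T G (Eq j k) -> deriv T G (Eq i k).
Proof.
move=> Gij Gjk; have := d_EqE (p := Eq (shift i) ord0) Gjk.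
by rewrite /inst /= !scons_ord0 !scons_shift; apply.
Qed.

Lemma deriv_subst_eq S (T : theory S) m n (G : seq (form S n))
    (r r' : 'I_m -> 'I_n) (p : form S m) :
  (forall i, deriv T G (Eq (r i) (r' i))) -> deriv T G (subst r p) ->
  deriv T G (subst r' p).
Proof.
(* [d_EqE] replaces one variable at a time, so [r] is turned into [r'] through the hybrids [s k]. *)
move=> Grr' Gr; pose s k (i : 'I_m) := if i < k then r' i else r i.
suff Gs k : k <= m -> deriv T G (subst (s k) p).
  rewrite (_ : subst r' p = subst (s m) p); first exact: Gs.
  by apply: subst_ext => i; rewrite /s ltn_ord.
elim: k => [_|k IHk lt_km]; first by rewrite (subst_ext (r' := r)).
pose o := Ordinal lt_km.
(* The formula with a hole at position [k]: filling it with [r o] or [r' o] gives two consecutive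
   hybrids. *)
pose q := subst (fun i => if i == o then ord0 else shift (s k i)) p.
have instq x : inst x q = subst (fun i => if i == o then x else s k i) p.
  rewrite /inst subst_comp; apply: subst_ext => i /=.
  by case: eqP; rewrite ?scons_ord0 ?scons_shift.
have instk : inst (r o) q = subst (s k) p.
  by rewrite instq; apply: subst_ext => i; case: eqP => // ->; rewrite /s ltnn.
have instSk : inst (r' o) q = subst (s k.+1) p.
  rewrite instq; apply: subst_ext => i; rewrite /s ltnS.
  case: (eqVneq i o) => [->|]; first by rewrite /= leqnn.
  by rewrite -(inj_eq val_inj) /= [i <= k]leq_eqVlt => /negbTE->.
rewrite -instSk; apply: (d_EqE (Grr' o)); rewrite instk.
by apply: IHk; apply: ltnW.
Qed.

(** Every atom is a renaming of the generic one on [ord_tuple]. *)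
Lemma deriv_rel_eq S (T : theory S) n (G : seq (form S n)) (R : symbol S)
    (u w : (arity R).-tuple 'I_n) :
  (forall i, deriv T G (Eq (tnth u i) (tnth w i))) ->
  deriv T G (Rel R u) -> deriv T G (Rel R w).
Proof.
have relE (v : (arity R).-tuple 'I_n) :
    Rel R v = subst (tnth v) (Rel R (ord_tuple (arity R))).
  by congr Rel; apply: eq_from_tnth => i; rewrite tnth_map tnth_ord_tuple.
by rewrite !relE; apply: deriv_subst_eq.
Qed.

Lemma deriv_cut S (T : theory S) n (G : seq (form S n)) p q :
  deriv T G p -> deriv T (p :: G) q -> deriv T G q.
Proof. by move=> Gp Gpq; apply: d_ImpE Gp; apply: d_ImpI. Qed.

(** A squashed proof eliminates into strict propositions only; once [P] is decided, it is used just
    to refute the negative case, by way of [sEmpty]. *)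
Definition unsquash_dec (P : Prop) (decP : dec P) (sq : StrictProp.Squash P) :
    P :=
  match decP with
  | or_introl p => p
  | or_intror np =>
    match match sq with
          | StrictProp.squash p =>
            match np p return StrictProp.sEmpty with end
          end
    with end
  end.

(** * Types coded by decidable sets of natural numbers *)

Definition coding (X : Type) (code : X -> nat) : Prop :=
  injective code /\ forall n, dec (exists x, code x = n).

Lemma coding_pair X (code : X -> nat) :
  coding code -> coding (fun u : X * X => pickle (code u.1, code u.2)).
Proof.
move=> [inj dec_code]; split.
  by move=> [x y] [x' y'] /(pcan_inj (@pickleK _))[/inj-> /inj->].
move=> n; have decP (u : nat * nat) :
    dec ((exists x, code x = u.1) /\ (exists y, code y = u.2)).
  by apply: Decidable.dec_and.
apply: dec_iff (dec_pickle n decP); split.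
  by move=> [[a b] [<- [/= [x <-] [y <-]]]]; exists (x, y).
by move=> [[x y] <-]; exists (code x, code y); split=> //=; split; [exists x | exists y].
Qed.

Lemma coding_tuple X (code : X -> nat) k :
  coding code -> coding (fun u : k.-tuple X => pickle (map code u)).
Proof.
move=> [inj dec_code]; split.
  by move=> u v /(pcan_inj (@pickleK _))/(inj_map inj)/val_inj.
move=> n; have decP (w : seq nat) :
    dec (size w = k /\ forall i, i < size w -> exists x, code x = nth 0 w i).
  apply: Decidable.dec_and; first exact: dec_eq.
  by apply: dec_ltn_all.
apply: dec_iff (dec_pickle n decP); split.
  move=> [w [<- [<- wP]]].
  suff [s Es] : exists s, map code s = w.
    have Hs : size s == size w by rewrite -Es size_map.
    by exists (Tuple Hs); rewrite /= Es.
  elim: w wP => [|a w IHw] wP; first by exists [::].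
  have [x Ex] := wP 0 isT; have [s Es] := IHw (fun i => wP i.+1).
  by exists (x :: s); rewrite /= Ex Es.
move=> [u <-]; exists (map code u); split; rewrite ?size_map ?size_tuple //.
split=> // i lt_i; exists (tnth u (Ordinal lt_i)).
have x0 := tnth u (Ordinal lt_i).
by rewrite (tnth_nth x0) (nth_map x0) ?size_tuple.
Qed.

(** The listing runs over pairs of a code and a witness. *)
Lemma coding_enumerable X (code : X -> nat) (P : X -> Prop)
    (g : X -> nat -> Prop) :
  coding code -> (forall x n, dec (g x n)) ->
  (forall x, P x <-> exists n, g x n) -> enumerable P.
Proof.
move=> [inj dec_code] decg Pg.
apply: (@listing_enumerable _ _ (fun j x =>
  exists n, pickle (code x, n) = j /\ g x n)).
  move=> x y _ _; apply: dec_iff (dec_eq (code x) (code y)).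
  by split=> [/inj|->].
split.
- by move=> j x y [n [<- _]] [m [/(pcan_inj (@pickleK _))[/inj-> _] _]].
- move=> j; have decP (u : nat * nat) : dec (exists x, code x = u.1 /\ g x u.2).
    apply: dec_ex_unique (dec_code _) _ _ => // x y Ex Ey.
    by apply: inj; rewrite Ex.
  apply: dec_iff (dec_pickle j decP); split.
    by move=> [[a n] [<- [x [/= <- gx]]]]; exists x, n.
  by move=> [x [n [<- gx]]]; exists (code x, n); split=> //; exists x.
- move=> x; rewrite Pg; split=> [[n gx]|[j [n [_ gx]]]]; last by exists n.
  by exists (pickle (code x, n)), n.
Qed.

(** Finite choice is provable by induction on [k]. *)
Lemma fin_choice X k (Q : 'I_k -> X -> Prop) :
  (forall i, exists x, Q i x) -> exists e, forall i, Q i (e i).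
Proof.
elim: k Q => [|k IHk] Q exQ.
  by exists (fun i : 'I_0 => False_rect X (notF (ltn_ord i))) => -[].
have [x Qx] := exQ ord0; have [e Qe] := IHk (fun i => Q (shift i)) (fun i => exQ _).
by exists (scons x e); apply: ord_shiftP => [|i]; rewrite ?scons_ord0 ?scons_shift.
Qed.

(** * States of the chase and forcing *)

Section Chase.

Variable S : signature.

(* The constants of a state [(N, G)] are the numbers below [N]; the fact
   [Fact p v] asserts [p] with its variable [i] denoting the constant [v_i]. *)
Record fact := Fact {
  fact_ctx : nat;
  fact_form : form S fact_ctx;
  fact_env : seq nat
}.

Definition state : Type := nat * seq fact.

(** As in union-find, an equation redirects the class of its right side to the representative of its
    left side. Thus [rep G] decides the equivalence generated by the equations in [G]. *)
Definition merge (rho : nat -> nat) (f : fact) : nat -> nat :=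
  let: Fact _ p v := f in
  if p is Eq i j then
    fun x => if rho x == rho (nth 0 v j) then rho (nth 0 v i) else rho x
  else rho.

Definition rep (G : seq fact) : nat -> nat := foldl merge id G.

Definition asserts (rho : nat -> nat) R (u : seq nat) (f : fact) : Prop :=
  let: Fact _ p v := f in
  if p is Rel R' args then
    R' = R /\ map rho [seq nth 0 v (nat_of_ord i) | i <- args] = map rho u
  else False.

Definition forces_rel (st : state) R (u : seq nat) : Prop :=
  exists f, List.In f st.2 /\ asserts (rep st.2) R u f.

(** Truth in the finite structure given by the atomic facts of [st]; compound facts count only once
    decomposed. The non-positive connectives are never forced, which keeps forcing monotone. *)
Fixpoint forces (st : state) n (e : 'I_n -> nat) (p : form S n) {struct p} :
    Prop :=
  match p with
  | Rel R args => forces_rel st R (map e args)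
  | Eq i j => rep st.2 (e i) = rep st.2 (e j)
  | Top => True
  | And p q => forces st e p /\ forces st e q
  | Or p q => forces st e p \/ forces st e q
  | Ex p => exists c, c < st.1 /\ forces st (scons c e) p
  | Bot | Imp _ _ | All _ => False
  end.

Definition extends (st st' : state) : Prop :=
  st.1 <= st'.1 /\ exists H, st'.2 = st.2 ++ H.

Lemma extends_refl st : extends st st.
Proof. by split=> //; exists [::]; rewrite cats0. Qed.

Lemma extends_trans st1 st2 st3 :
  extends st1 st2 -> extends st2 st3 -> extends st1 st3.
Proof.
move=> [le12 [H1 E1]] [le23 [H2 E2]]; split; first exact: leq_trans le23.
by exists (H1 ++ H2); rewrite E2 E1 catA.
Qed.

Lemma extends_In st st' f : extends st st' -> List.In f st.2 -> List.In f st'.2.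
Proof. by move=> [_ [H ->]] Gf; apply/List.in_or_app; left. Qed.

(** Facts are appended at the end, so a task can name a fact by its position once and for all. *)
Lemma extends_onth st st' i f :
  extends st st' -> onth st.2 i = Some f -> onth st'.2 i = Some f.
Proof.
by move=> [_ [H ->]] Ei; rewrite onth_cat -onthTE Ei.
Qed.

Lemma In_onth (X : Type) (s : seq X) x : List.In x s -> exists i, onth s i = Some x.
Proof.
elim: s => //= y s IHs [->|/IHs[i Ei]]; first by exists 0.
by exists i.+1.
Qed.

Lemma onth_In (X : Type) (s : seq X) i x : onth s i = Some x -> List.In x s.
Proof.
by elim: s i => [|y s IHs] [|i] //= => [[]|/IHs]; [left | right].
Qed.

Lemma foldl_merge_eq rho H x y :
  rho x = rho y -> foldl merge rho H x = foldl merge rho H y.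
Proof.
elim: H rho => //= f H IHH rho Exy; apply: IHH.
by case: f => m [] //= i j v; rewrite Exy.
Qed.

Lemma rep_extends st st' x y :
  extends st st' -> rep st.2 x = rep st.2 y -> rep st'.2 x = rep st'.2 y.
Proof. by move=> [_ [H ->]]; rewrite /rep foldl_cat; apply: foldl_merge_eq. Qed.

Lemma rep_fact G m (i j : 'I_m) v :
  List.In (Fact (Eq i j) v) G -> rep G (nth 0 v i) = rep G (nth 0 v j).
Proof.
move=> /(List.in_split _ _)[G1 [G2 ->]]; rewrite /rep foldl_cat /=.
by apply: foldl_merge_eq; rewrite eqxx; case: eqP.
Qed.

Lemma map_rep_extends st st' u w :
  extends st st' -> map (rep st.2) u = map (rep st.2) w ->
  map (rep st'.2) u = map (rep st'.2) w.
Proof.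
move=> ext; elim: u w => [|x u IHu] [|y w] //= [Exy /IHu ->].
by rewrite (rep_extends ext Exy).
Qed.

Lemma forces_rel_extends st st' R u :
  extends st st' -> forces_rel st R u -> forces_rel st' R u.
Proof.
move=> ext [f [Gf Hf]]; exists f; split; first exact: extends_In Gf.
by case: f Hf {Gf} => m [] //= R' args v [ER /(map_rep_extends ext)].
Qed.

Lemma forces_ext st n (e e' : 'I_n -> nat) p :
  e =1 e' -> forces st e p -> forces st e' p.
Proof.
elim: p e e' => //= {n}.
- by move=> n R args e e' ee'; rewrite (eq_map ee').
- by move=> n i j e e' ee'; rewrite !ee'.
- by move=> n p IHp q IHq e e' ee' [/(IHp _ _ ee') ? /(IHq _ _ ee')].
- by move=> n p IHp q IHq e e' ee' [/(IHp _ _ ee')|/(IHq _ _ ee')]; [left|right].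
- move=> n p IHp e e' ee' [c [lt_c Hc]]; exists c; split=> //.
  exact: IHp (scons_eq c ee') Hc.
Qed.

Lemma forces_extends st st' n (e : 'I_n -> nat) p :
  extends st st' -> forces st e p -> forces st' e p.
Proof.
move=> ext; elim: p e => //= {n}.
- by move=> n R args e; apply: forces_rel_extends.
- by move=> n i j e; apply: rep_extends.
- by move=> n p IHp q IHq e [/IHp ? /IHq].
- by move=> n p IHp q IHq e [/IHp|/IHq]; [left | right].
- move=> n p IHp e [c [lt_c /IHp Hc]]; exists c; split=> //.
  by apply: leq_trans lt_c _; case: ext.
Qed.

Definition decompose (b : nat) (st : state) (f : fact) : state :=
  let: Fact _ p v := f in
  match p with
  | And p q => (st.1, st.2 ++ [:: Fact p v; Fact q v])
  | Or p q => (st.1, st.2 ++ [:: Fact (if b == 0 then p else q) v])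
  | Ex p => (st.1.+1, st.2 ++ [:: Fact p (st.1 :: v)])
  | _ => st
  end.

Lemma decompose_extends b st f : extends st (decompose b st f).
Proof.
case: f => m p v; case: p => *; try exact: extends_refl.
all: by split; [rewrite /= ?leqW | eexists].
Qed.

(* [inl i]: decompose the [i]-th fact; [inr (n, v)]: apply the [n]-th axiom to
   the constants [v].  Each task recurs infinitely often. *)
Definition task (t : nat) : option (nat + nat * seq nat) := unpickle (logn 2 t).

Lemma task_recurs x t0 : exists t, t0 <= t /\ task t = Some x.
Proof.
(* The power of 2 codes the task; the power of 3 makes the number large without changing its 2-adic
   valuation. *)
exists (2 ^ pickle x * 3 ^ t0); split; last first.
  rewrite /task lognM ?expn_gt0 // pfactorK // lognX.
  by rewrite (_ : logn 2 3 = 0) // muln0 addn0 pickleK.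
apply: leq_trans (ltnW (ltn_expl t0 (isT : 1 < 3))) _.
by rewrite leq_pmull ?expn_gt0.
Qed.

Variables (T : theory S) (L : nat -> sequent S -> Prop).
Hypothesis decS : forall R R' : symbol S, dec (R = R').
Hypothesis LP : listing T L.

Definition fires n v (st : state) (s : sequent S) : Prop :=
  L n s /\ [/\ size v = context s, all (fun c => c < st.1) v
             & forces st (fun i => nth 0 v i) (antecedent s)].

(** A relation, because axioms are listed by a relation; leaving the state alone when nothing fires
    makes it total. *)
Definition step (t b : nat) (st st' : state) : Prop :=
  match task t with
  | Some (inl i) =>
    st' = if onth st.2 i is Some f then decompose b st f else st
  | Some (inr (n, v)) =>
    (exists s, fires n v st s /\ st' = (st.1, st.2 ++ [:: Fact (succedent s) v]))
    \/ ((forall s, ~ fires n v st s) /\ st' = st)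
  | None => st' = st
  end.

Lemma dec_forces_rel st R u : dec (forces_rel st R u).
Proof.
apply: dec_list_ex => -[m [] /=] *; try by right.
by apply: Decidable.dec_and; [apply: decS | apply: dec_eq].
Qed.

Lemma dec_forces st n (e : 'I_n -> nat) p : dec (forces st e p).
Proof.
elim: p e => //= {n}; try by [left | right].
- by move=> n R args e; apply: dec_forces_rel.
- by move=> n i j e; apply: dec_eq.
- by move=> n p IHp q IHq e; apply: Decidable.dec_and.
- by move=> n p IHp q IHq e; apply: Decidable.dec_or.
- by move=> n p IHp e; apply: dec_ltn_ex => c _.
Qed.

Lemma step_total t b st : exists st', step t b st st'.
Proof.
rewrite /step; case: (task t) => [[i|[n v]]|]; try by eexists.
have [Lf Ld _] := LP.
case: (@dec_ex_unique _ (L n) (fun s => [/\ size v = context s,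
    all (fun c => c < st.1) v
  & forces st (fun i => nth 0 v i) (antecedent s)]) (Ld n) (Lf n))
  => [s _|[s Hs]|nfires].
- have decs := Decidable.dec_and _ _ (dec_bool (all (fun c => c < st.1) v))
    (dec_forces st (fun i => nth 0 v (nat_of_ord i)) (antecedent s)).
  apply: dec_iff (Decidable.dec_and _ _ (dec_eq (size v) (context s)) decs).
  by split=> [[? []]|[]].
- by eexists; left; exists s; split; first exact: Hs.
- by exists st; right; split=> // s Hs; apply: nfires; exists s.
Qed.

Lemma step_functional t b st st1 st2 :
  step t b st st1 -> step t b st st2 -> st1 = st2.
Proof.
rewrite /step; case: (task t) => [[i|[n v]]|]; try by move=> -> ->.
have [Lf _ _] := LP.
case=> [[s [Hs ->]]|[nfires ->]] [[s' [Hs' ->]]|[nfires' ->]] //.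
- by rewrite (Lf n s s') //; [case: Hs | case: Hs'].
- by case: (nfires' s).
- by case: (nfires s').
Qed.

Lemma step_extends t b st st' : step t b st st' -> extends st st'.
Proof.
rewrite /step; case: (task t) => [[i|[n v]]|].
- by move=> ->; case: (onth _ _) => [f|];
    [apply: decompose_extends | apply: extends_refl].
- case=> [[s [_ ->]]|[_ ->]]; last exact: extends_refl.
  by split=> //; eexists.
- by move=> ->; apply: extends_refl.
Qed.

(** * Runs of the chase along finite sequences *)

Variable goal : sequent S.

Let k := context goal.

(* In context [N] the constant [c] is the variable [N - c.+1], so that a new
   constant is the variable bound by the eliminated quantifier. *)
Definition init_env : seq nat := mkseq (fun i => k - i.+1) k.

Definition init_state : state := (k, [:: Fact (antecedent goal) init_env]).

Inductive run : seq nat -> state -> Prop :=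
| run_nil : run [::] init_state
| run_rcons s b st st' :
    run s st -> step (size s) b st st' -> run (rcons s b) st'.

Lemma run_nilE st : run [::] st -> st = init_state.
Proof.
move Es: [::] => s runs; case: runs Es => // s' b st1 st2 _ _.
by case: s'.
Qed.

Lemma run_rconsE s b st' :
  run (rcons s b) st' -> exists st, run s st /\ step (size s) b st st'.
Proof.
move Et: (rcons s b) => t runt; case: runt Et => [|t' c st1 st2 run1 step1].
  by case: s.
by move=> /rcons_inj[-> ->]; exists st1.
Qed.

Lemma run_total s : exists st, run s st.
Proof.
elim/last_ind: s => [|s b [st run_s]]; first by exists init_state; constructor.
by have [st' step_s] := step_total (size s) b st; exists st'; econstructor; eauto.
Qed.

Lemma run_functional s st st' : run s st -> run s st' -> st = st'.
Proof.
elim/last_ind: s st st' => [|s b IHs] st st'; first by move=> /run_nilE-> /run_nilE.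
move=> /run_rconsE[st1 [run1 step1]] /run_rconsE[st2 [run2 step2]].
rewrite -(IHs _ _ run1 run2) in step2.
exact: step_functional step1 step2.
Qed.

Lemma run_extends s t st st' : run s st -> run (s ++ t) st' -> extends st st'.
Proof.
move=> run_s; elim/last_ind: t st' => [|t b IHt] st'.
  by rewrite cats0 => /(run_functional run_s)<-; apply: extends_refl.
rewrite -rcons_cat => /run_rconsE[st1 [/IHt ext /step_extends]].
exact: extends_trans.
Qed.

Definition reaches_goal (s : seq nat) : Prop :=
  exists st, run s st /\ forces st (fun i => nth 0 init_env i) (succedent goal).

Lemma dec_reaches_goal s : dec (reaches_goal s).
Proof.
have [st run_s] := run_total s.
case: (dec_forces st (fun i => nth 0 init_env i) (succedent goal)) => H.
  by left; exists st.
by right=> -[st' [run' H']]; rewrite (run_functional run_s run') in H.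
Qed.

(** * From the tree of states to a derivation *)

Definition agree N m (r : 'I_m -> 'I_N) (v : seq nat) : Prop :=
  forall i : 'I_m, nth 0 v i = rev_ord (r i).

Definition holds (st : state) (G : seq (form S st.1)) : Prop :=
  forall f, List.In f st.2 ->
  exists r : 'I_(fact_ctx f) -> 'I_(st.1),
    agree r (fact_env f) /\ List.In (subst r (fact_form f)) G.

Lemma holds_cat (st : state) (G G' : seq (form S st.1)) H :
  holds G -> List.incl G G' ->
  (forall f, List.In f H -> exists r : 'I_(fact_ctx f) -> 'I_(st.1),
    agree r (fact_env f) /\ List.In (subst r (fact_form f)) G') ->
  @holds (st.1, st.2 ++ H) G'.
Proof.
move=> holdG GG' holdH f Hf; case: (List.in_app_or _ _ _ Hf) => [Gf|/holdH//].
by have [r [agr /GG' Gr]] := holdG f Gf; exists r.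
Qed.

(** Each merge is justified by a hypothesis in [G]. The induction is over the facts still to be
    merged, for any [rho] whose identifications are derivable. *)
Lemma deriv_rep_eq (st : state) (G : seq (form S st.1)) :
  holds G -> forall i j : 'I_(st.1),
  rep st.2 (rev_ord i) = rep st.2 (rev_ord j) -> deriv T G (Eq i j).
Proof.
move=> holdG.
suff gen F rho : List.incl F st.2 ->
    (forall i j : 'I_(st.1),
       rho (rev_ord i : nat) = rho (rev_ord j : nat) -> deriv T G (Eq i j)) ->
    forall i j : 'I_(st.1),
      foldl merge rho F (rev_ord i) = foldl merge rho F (rev_ord j) ->
      deriv T G (Eq i j).
  apply: gen => [f //|i j Eij].
  by have /rev_ord_inj -> : rev_ord i = rev_ord j by [apply: val_inj]; apply: d_EqI.
elim: F rho => [rho _ rhoG|f F IHF rho subF rhoG] /=; first exact: rhoG.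
apply: IHF => [f' Hf'|]; first by apply: subF; right.
have := holdG f (subF _ (or_introl erefl)).
case: f {subF} => m p v [/= r [agr]] Gr i j.
case: p Gr; try by move=> *; apply: rhoG.
move=> a b Gr; rewrite /= !agr.
have ab : deriv T G (Eq (r a) (r b)) := d_Hyp T Gr.
(* [Ei] and [Ej] tell whether the merge moves [i] and [j]; if it moves just one of them, the chain
   of equalities passes through [ab]. *)
case: eqP => Ei; case: eqP => Ej.
- move=> _; apply: deriv_eq_trans (rhoG _ _ Ei) _; apply: rhoG; exact: esym.
- move=> Eaj; apply: deriv_eq_trans (rhoG _ _ Ei) _.
  by apply: deriv_eq_trans (deriv_eq_sym ab) _; apply: rhoG.
- move=> Eia; apply: deriv_eq_trans (rhoG _ _ Eia) _.
  by apply: deriv_eq_trans ab _; apply: rhoG; apply: esym.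
- exact: rhoG.
Qed.

(** Forcing unfolds into introduction rules; a forced atom is a hypothesis up to equalities from
    [deriv_rep_eq]. *)
Lemma deriv_forces (st : state) (G : seq (form S st.1)) n (e : 'I_n -> nat)
    (r : 'I_n -> 'I_(st.1)) p :
  holds G -> (forall i, e i = rev_ord (r i)) -> forces st e p ->
  deriv T G (subst r p).
Proof.
move=> holdG; elim: p e r => //= {n}.
- move=> n R args e r er [[m q v] [Gf]]; case: q Gf => //= R' args' Gf [ER].
  move: args' Gf; rewrite {}ER => args' Gf Eargs.
  have [r' [/= agr Gr']] := holdG _ Gf.
  apply: deriv_rel_eq (d_Hyp _ Gr') => i; rewrite !tnth_map.
  apply: (deriv_rep_eq holdG); rewrite -agr /= -er.
  have /(congr1 (nth 0 ^~ i)) := Eargs.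
  rewrite -!map_comp !(nth_map (tnth args i)) ?size_tuple //.
  rewrite (nth_map (tnth args' i)) ?size_tuple // => E.
  by rewrite (tnth_nth (tnth args' i)) (tnth_nth (tnth args i)).
- by move=> n i j e r er; rewrite !er; apply: deriv_rep_eq.
- by move=> *; apply: d_TopI.
- by move=> n p IHp q IHq e r er [/(IHp _ _ er) ? /(IHq _ _ er) ?]; apply: d_AndI.
- move=> n p IHp q IHq e r er [/(IHp _ _ er)|/(IHq _ _ er)].
    exact: d_OrIl.
  exact: d_OrIr.
- move=> n p IHp e r er [c [lt_c Hc]].
  apply: (@d_ExI _ _ _ _ _ (rev_ord (Ordinal lt_c))).
  rewrite inst_subst_up; apply: IHp Hc.
  apply: ord_shiftP => [|i]; rewrite ?scons_ord0 ?scons_shift //.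
  exact: esym (congr1 val (rev_ordK (Ordinal lt_c))).
Qed.

(** This is the gain of the reversed numbering: a new variable raises both the context and the old
    indices by one, so old constants keep their names. *)
Lemma agree_shift N m (r : 'I_m -> 'I_N) v : agree r v -> agree (shift \o r) v.
Proof. by move=> agr i; rewrite agr /= /bump leq0n add1n subSS. Qed.

Lemma agree_exists N m v :
  size v = m -> all (fun c => c < N) v -> exists r : 'I_m -> 'I_N, agree r v.
Proof.
move=> Ev /(all_nthP 0) ltv.
have lt_v (i : 'I_m) : nth 0 v i < N by apply: ltv; rewrite Ev.
exists (fun i => rev_ord (Ordinal (lt_v i))) => i.
by rewrite rev_ordK.
Qed.

(** Quantified over every [G] containing the facts, so that hypotheses may accumulate. *)
Definition derives_goal (st : state) : Prop :=
  forall (G : seq (form S st.1)) (r : 'I_k -> 'I_(st.1)),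
  holds G -> agree r init_env -> deriv T G (subst r (succedent goal)).

(** Elimination rules read backwards: cuts for a conjunction, [d_OrE] with one branch per bit for a
    disjunction, [d_ExE] with the new constant as its variable. *)
Lemma derives_goal_decompose (st : state) f :
  List.In f st.2 -> (forall b, b < 2 -> derives_goal (decompose b st f)) ->
  derives_goal st.
Proof.
case: st f => N F [m p v] Ff next G r0 holdG agr0.
have [/= r [agr Gp]] := holdG _ Ff.
case: p Ff r agr Gp next => [R a|a b|||p q|p q|p q|p|p] Ff r agr /= Gp next;
  try exact: (next 0 isT G r0 holdG agr0).
- apply: deriv_cut (d_AndEl (d_Hyp T Gp)) _.
  have Gp' := or_intror Gp : List.In (And (subst r p) (subst r q)) (subst r p :: G).
  apply: deriv_cut (d_AndEr (d_Hyp T Gp')) _; apply: (next 0 isT _ r0) agr0.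
  apply: (holds_cat holdG) => [f Gf|_ [<-|[<-|[]]]]; first by right; right.
    by exists r; split=> //; right; left.
  by exists r; split=> //; left.
- apply: d_OrE (d_Hyp T Gp) _ _.
    apply: (next 0 isT _ r0) agr0.
    apply: (holds_cat holdG) => [f Gf|_ [<-|[]]]; first by right.
    by exists r; split=> //; left.
  apply: (next 1 isT _ r0) agr0.
  apply: (holds_cat holdG) => [f Gf|_ [<-|[]]]; first by right.
  by exists r; split=> //; left.
- apply: d_ExE (d_Hyp T Gp) _; rewrite subst_comp.
  apply: (next 0 isT _ (shift \o r0)); last exact: agree_shift.
  move=> f Hf; case: (List.in_app_or _ _ _ Hf) => [/holdG[r' [agr' Gf]]|[<-|[]]].
    exists (shift \o r'); split; first exact: agree_shift.
    by rewrite -subst_comp; right; apply: List.in_map.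
  (* In context [N.+1] the variable [ord0] denotes [N], the new constant. *)
  exists (up r); split; last by left.
  apply: ord_shiftP => [|i]; rewrite /up ?scons_ord0 ?scons_shift /=.
    by rewrite subSS subn0.
  by rewrite /bump leq0n add1n subSS; apply: agr.
Qed.

Lemma derives_goal_fires n v (st : state) s :
  fires n v st s -> derives_goal (st.1, st.2 ++ [:: Fact (succedent s) v]) ->
  derives_goal st.
Proof.
move=> [Ls [Ev ltv Hs]] next G r0 holdG agr0.
have [r agr] := agree_exists Ev ltv.
have Ts : T s by have [_ _ ->] := LP; exists n.
have Gs : deriv T G (subst r (succedent s)).
  case: s r {Ls Ev next} Ts agr Hs => m p q r Ts agr Hs.
  by apply: d_Ax Ts (deriv_forces holdG agr Hs).
apply: deriv_cut Gs _; apply: next agr0.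
apply: (holds_cat holdG) => [f|_ [<-|[]]]; first by right.
by exists r; split=> //; left.
Qed.

Lemma derives_goal_step t (st : state) :
  (forall b st', b < 2 -> step t b st st' -> derives_goal st') ->
  derives_goal st.
Proof.
have [st' Hst'] := step_total t 0 st; move: Hst'; rewrite /step.
case: (task t) => [[i|[n v]]|] Hst' next; last exact: (next 0 st).
  case Ei: (onth st.2 i) next => [f|] next; last exact: (next 0 st).
  by apply: (derives_goal_decompose (onth_In Ei)) => b b2; apply: next b2 _.
case: Hst' => [[s [Hs Est]]|[nf Est]].
  by apply: (derives_goal_fires Hs); apply: (next 0) => //; left; exists s.
by apply: (next 0 st) => //; right.
Qed.

Definition binary (s : seq nat) : bool := all (fun i => i < 2) s.

(** Backward induction from the leaves of the binary tree of height [m] to its root. *)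
Lemma derives_goal_run m :
  (forall s, binary s -> size s = m -> reaches_goal s) ->
  forall s st, binary s -> size s <= m -> run s st -> derives_goal st.
Proof.
move=> reach s st bin_s le_sm; move Ed: (m - size s) => d.
elim: d s st Ed bin_s le_sm => [|d IHd] s st Ed bin_s le_sm run_s.
  have /(reach s bin_s)[st' [run' Hst']] : size s = m.
    by apply/eqP; rewrite eqn_leq le_sm -subn_eq0 Ed.
  rewrite -(run_functional run_s run') in Hst' => G r holdG agr.
  exact: (deriv_forces holdG agr Hst').
apply: (@derives_goal_step (size s)) => b st' b2 step_s.
apply: (IHd (rcons s b)); last by econstructor; eauto.
- by rewrite size_rcons subnS Ed.
- by rewrite /binary all_rcons b2.
- by rewrite size_rcons -subn_gt0 Ed.
Qed.

(** * The limit of the chase along a path *)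

Section Path.

Variable alpha : nat -> nat -> Prop.
Hypothesis alpha_fun : forall i, exists! b, alpha i b.

Definition at_stage n (st : state) : Prop :=
  exists s, [/\ initial_segment alpha s, size s = n & run s st].

Lemma at_stage_total n : exists st, at_stage n st.
Proof.
have [s [init_s Es]] := initial_segment_exists n alpha_fun.
by have [st run_s] := run_total s; exists st, s.
Qed.

Lemma at_stage_functional n st st' : at_stage n st -> at_stage n st' -> st = st'.
Proof.
move=> [s [init_s Es run_s]] [t [init_t Et run_t]].
have Est := initial_segment_unique alpha_fun init_s init_t (etrans Es (esym Et)).
by rewrite -Est in run_t; apply: run_functional run_s run_t.
Qed.

Lemma at_stageS n st : at_stage n st ->
  exists b st', at_stage n.+1 st' /\ step n b st st'.
Proof.
move=> [s [init_s Es run_s]]; have [b [ab _]] := alpha_fun n.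
have [st' step_s] := step_total n b st; exists b, st'; split=> //.
rewrite -{1}Es in ab; exists (rcons s b); split.
- by apply/initial_segment_rcons.
- by rewrite size_rcons Es.
- by apply: run_rcons run_s _; rewrite Es.
Qed.

Lemma at_stage_extends n m st st' :
  n <= m -> at_stage n st -> at_stage m st' -> extends st st'.
Proof.
elim: m st' => [|m IHm] st'.
  by rewrite leqn0 => /eqP-> /at_stage_functional Est /Est<-; apply: extends_refl.
rewrite leq_eqVlt => /orP[/eqP-> /at_stage_functional Est /Est<-|].
  exact: extends_refl.
rewrite ltnS => le_nm at_n at_m1; have [st1 at_m] := at_stage_total m.
have [b [st2 [at_m2 step2]]] := at_stageS at_m.
apply: extends_trans (IHm _ le_nm at_n at_m) _.
by rewrite (at_stage_functional at_m1 at_m2); apply: step_extends step2.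
Qed.

(** Truth in the limit. Since stages only grow, finitely many persistent properties that hold
    eventually hold at a common stage. *)
Definition eventually (Q : state -> Prop) : Prop :=
  exists n st, at_stage n st /\ Q st.

Definition persistent (Q : state -> Prop) : Prop :=
  forall st st', extends st st' -> Q st -> Q st'.

Lemma eventually_after n (Q : state -> Prop) : persistent Q -> eventually Q ->
  exists m st, [/\ n <= m, at_stage m st & Q st].
Proof.
move=> monoQ [m [st [at_m Qst]]]; have [st' at'] := at_stage_total (maxn n m).
exists (maxn n m), st'; split=> //; first exact: leq_maxl.
exact: monoQ (at_stage_extends (leq_maxr n m) at_m at') Qst.
Qed.

Lemma eventually_and (Q Q' : state -> Prop) : persistent Q -> persistent Q' ->
  eventually Q -> eventually Q' -> eventually (fun st => Q st /\ Q' st).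
Proof.
move=> monoQ monoQ' [n [st [at_n Qst]]].
move=> /(eventually_after n monoQ')[m [st' [le_nm at_m Q'st]]].
exists m, st'; do 2 split=> //.
exact: monoQ (at_stage_extends le_nm at_n at_m) Qst.
Qed.

Lemma eventually_forall n (Q : 'I_n -> state -> Prop) :
  (forall i, persistent (Q i)) -> (forall i, eventually (Q i)) ->
  eventually (fun st => forall i, Q i st).
Proof.
elim: n Q => [|n IHn] Q monoQ evQ.
  by have [st at0] := at_stage_total 0; exists 0, st; split=> // -[].
have [n0 [st [at_n [Q0 QS]]]] := eventually_and (monoQ ord0)
  (fun st st' ext (H : forall i, Q (shift i) st) i => monoQ _ _ _ ext (H i))
  (evQ ord0) (IHn (fun i => Q (shift i)) (fun i => monoQ _) (fun i => evQ _)).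
by exists n0, st; split=> //; apply: ord_shiftP.
Qed.

Definition born c n : Prop := exists st, at_stage n st /\ c < st.1.

Lemma dec_born c n : dec (born c n).
Proof.
have [st at_n] := at_stage_total n; case: (ltnP c st.1) => [lt_c|le_c].
  by left; exists st.
by right=> -[st' [/(at_stage_functional at_n)<-]]; rewrite ltnNge le_c.
Qed.

(* An element is a constant together with the stage at which it appears: the
   latter makes the domain a decidable subset of [nat * nat], so that the proof
   of membership can be squashed and still be recovered. *)
Definition first_born (x : nat * nat) : Prop :=
  born x.1 x.2 /\ forall j, j < x.2 -> ~ born x.1 j.

Lemma dec_first_born x : dec (first_born x).
Proof.
apply: Decidable.dec_and; first exact: dec_born.
by apply: dec_ltn_all => j _; apply: Decidable.dec_not; apply: dec_born.
Qed.

Definition element : Type :=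
  StrictProp.Ssig (fun x : nat * nat => StrictProp.Squash (first_born x)).

Definition constant (x : element) : nat := (StrictProp.Spr1 x).1.

Lemma element_first_born (x : element) : first_born (StrictProp.Spr1 x).
Proof.
by case: x => x sq; apply: unsquash_dec (dec_first_born x) sq.
Qed.

Lemma element_of c n : born c n -> exists x, constant x = c.
Proof.
move=> bc; have [m [_ bm minm]] := ex_least (dec_born c) bc.
by exists (StrictProp.Sexists _ (c, m) (StrictProp.squash (conj bm minm))).
Qed.

Definition element_code (x : element) : nat := pickle (StrictProp.Spr1 x).

Lemma element_code_inj : injective element_code.
Proof.
by move=> x y /(pcan_inj (@pickleK _)); apply: StrictProp.Spr1_inj.
Qed.

Lemma dec_element_code n : dec (exists x, element_code x = n).
Proof.
apply: dec_iff (dec_pickle n dec_first_born).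
split=> [[x [Ex fx]]|[x Ex]].
  by exists (StrictProp.Sexists _ x (StrictProp.squash fx)).
by exists (StrictProp.Spr1 x); split=> //; apply: element_first_born.
Qed.

Lemma born_persistent c : persistent (fun st => c < st.1).
Proof. by move=> st st' [le_st _] lt_c; apply: leq_trans le_st. Qed.

Lemma element_born x : eventually (fun st => constant x < st.1).
Proof.
by have [[st [at_n lt_x]] _] := element_first_born x; exists (StrictProp.Spr1 x).2, st.
Qed.

Lemma rep_persistent x y : persistent (fun st => rep st.2 x = rep st.2 y).
Proof. by move=> st st'; apply: rep_extends. Qed.

Lemma forces_rel_persistent R u : persistent (fun st => forces_rel st R u).
Proof. by move=> st st'; apply: forces_rel_extends. Qed.

Lemma forces_persistent n (e : 'I_n -> nat) p :
  persistent (fun st => forces st e p).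
Proof. by move=> st st'; apply: forces_extends. Qed.

(** Constants identified by the facts are related by [deq] and not quotiented, so equality of
    elements remains decidable. *)
Definition path_diagram : diagram S.
Proof.
refine (@Diagram S element
  (fun x y => eventually (fun st => rep st.2 (constant x) = rep st.2 (constant y)))
  (fun R u => eventually (fun st => forces_rel st R (map constant u)))
  _ _ _ _).
- by move=> x; have [st at0] := at_stage_total 0; exists 0, st.
- by move=> x y [n [st [at_n E]]]; exists n, st.
- move=> x y z xy yz.
  have [n [st [at_n [Exy Eyz]]]] := eventually_and
    (@rep_persistent _ _) (@rep_persistent _ _) xy yz.
  by exists n, st; rewrite Exy.
- move=> R u v uv Ru.
  have [n [st [at_n [Euv [f [Gf Hf]]]]]] := eventually_and
    (fun st st' ext H i => rep_extends ext (H i)) (@forces_rel_persistent _ _)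
    (eventually_forall (fun i => @rep_persistent _ _) uv) Ru.
  exists n, st; split=> //; exists f; split=> //.
  case: f Hf {Gf} => m [] //= R' args w [ER Hargs]; split=> //.
  rewrite Hargs -!map_comp; apply: (@eq_from_nth _ 0);
    rewrite !size_map ?size_tuple // => i lt_i.
  have x0 := tnth u (Ordinal lt_i).
  rewrite !(nth_map x0) ?size_tuple //=.
  by have := Euv (Ordinal lt_i); rewrite !(tnth_nth x0).
Defined.

Lemma dec_at_stage (Q : state -> Prop) n :
  (forall st, dec (Q st)) -> dec (exists st, at_stage n st /\ Q st).
Proof.
move=> decQ; apply: dec_ex_unique => [|st st'|st _]; last exact: decQ.
  by left; apply: at_stage_total.
exact: at_stage_functional.
Qed.

(** The stage number is the semi-decision witness: each stage has exactly one state, and forcing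
    there is decidable. *)
Lemma path_diagram_enumerable : enumerable_diagram path_diagram.
Proof.
have codeE : coding element_code.
  by split; [apply: element_code_inj | apply: dec_element_code].
split=> [||R].
- apply: (coding_enumerable (g := fun _ _ => True) codeE) => [x n|x].
    by left.
  by split=> // _; exists 0.
- apply: (coding_enumerable (coding_pair codeE)) (fun u => iff_refl _) => u n.
  by apply: dec_at_stage => st; apply: dec_eq.
- apply: (coding_enumerable (coding_tuple _ codeE)) (fun u => iff_refl _) => u n.
  by apply: dec_at_stage => st; apply: dec_forces_rel.
Qed.

(** The truth of a positive formula uses finitely many atomic facts and constants, all present at
    some stage. *)
Lemma eventually_forces n (e : 'I_n -> dom path_diagram) p :
  positive_coherent p -> sat e p ->
  eventually (fun st => forces st (fun i => constant (e i)) p).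
Proof.
elim: p e => //= {n}.
- move=> n R args e _ [m [st [at_m Hst]]]; exists m, st; split=> //.
  by rewrite -map_comp in Hst.
- by move=> n e _ _; have [st at0] := at_stage_total 0; exists 0, st.
- move=> n p IHp q IHq e /andP[pcp pcq] [/(IHp _ pcp) Hp /(IHq _ pcq) Hq].
  by apply: eventually_and Hp Hq; apply: forces_persistent.
- move=> n p IHp q IHq e /andP[pcp pcq].
  by case=> [/(IHp _ pcp)|/(IHq _ pcq)] [m [st [at_m Hst]]]; exists m, st; split=> //;
    [left | right].
- move=> n p IHp e pcp [x /(IHp _ pcp) Hx].
  have [m [st [at_m [lt_x Hp]]]] := eventually_and
    (@born_persistent _) (@forces_persistent _ _ _) (element_born x) Hx.
  exists m, st; split=> //; exists (constant x); split=> //.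
  apply: forces_ext Hp.
  by apply: ord_shiftP => [|i]; rewrite ?scons_ord0 ?scons_shift.
Qed.

(** The task for the position of [f] comes back after [f] has appeared. *)
Lemma fact_decomposed n st f : at_stage n st -> List.In f st.2 ->
  exists m b st', at_stage m st' /\ at_stage m.+1 (decompose b st' f).
Proof.
move=> at_n Gf; have [i Ei] := In_onth Gf; have [m [le_nm Em]] := task_recurs (inl i) n.
have [st' at_m] := at_stage_total m; have [b [st2 [at_m1 Hstep]]] := at_stageS at_m.
exists m, b, st'; split=> //; move: Hstep at_m1; rewrite /step Em.
by rewrite (extends_onth (at_stage_extends le_nm at_n at_m) Ei) => ->.
Qed.

Lemma sat_fact m (p : form S m) v (e : 'I_m -> dom path_diagram) n st :
  positive_coherent p -> at_stage n st -> List.In (Fact p v) st.2 ->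
  (forall i : 'I_m, nth 0 v i = constant (e i)) -> sat e p.
Proof.
elim: p v e n st => //= {m}.
- move=> m R args v e n st _ at_n Gf ve; exists n, st; split=> //.
  exists (Fact (Rel R args) v); split=> //=; split=> //.
  by rewrite -!map_comp; apply: eq_map => i /=; rewrite ve.
- move=> m i j v e n st _ at_n Gf ve; exists n, st; split=> //.
  by rewrite -!ve; apply: rep_fact.
- move=> m p IHp q IHq v e n st /andP[pcp pcq] at_n Gf ve.
  have [t [b [st' [_ at_t]]]] := fact_decomposed at_n Gf.
  split; [apply: IHp pcp at_t _ ve | apply: IHq pcq at_t _ ve];
    apply: List.in_or_app; right; [by left | by right; left].
- move=> m p IHp q IHq v e n st /andP[pcp pcq] at_n Gf ve.
  have [t [b [st' [_ at_t]]]] := fact_decomposed at_n Gf; move: at_t => /=.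
  case: (b == 0) => at_t; [left | right];
    [apply: IHp pcp at_t _ ve | apply: IHq pcq at_t _ ve];
    by apply: List.in_or_app; right; left.
- move=> m p IHp v e n st pcp at_n Gf ve.
  have [t [b [st' [_ at_t]]]] := fact_decomposed at_n Gf.
  (* The constant introduced by the decomposition is the witness; it exists from stage [t.+1] on. *)
  have [|x Ex] := @element_of st'.1 t.+1; first by eexists; split; first exact: at_t.
  exists x; apply: (IHp (st'.1 :: v) _ _ _ pcp at_t).
    by apply: List.in_or_app; right; left.
  by apply: ord_shiftP => [|i]; rewrite ?scons_ord0 ?scons_shift /= ?ve.
Qed.

(** A true antecedent is forced at a finite stage where its constants exist. The axiom fires at a
    later recurrence of its task, and its succedent is then a fact, true by [sat_fact]. *)
Lemma path_diagram_model :
  positive_coherent_theory T -> model_diagram T path_diagram.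
Proof.
move=> pcT s Ts e sat_s; have /andP[pcp pcq] := pcT s Ts.
have evp := eventually_forces pcp sat_s.
have evc : eventually (fun st => forall i, constant (e i) < st.1).
  apply: eventually_forall => i; first exact: born_persistent.
  exact: element_born.
have [n [st [at_n [ltc Hp]]]] := eventually_and
  (fun st st' ext H i => born_persistent ext (H i)) (@forces_persistent _ _ _)
  evc evp.
have [_ _ LT] := LP; have [a La] := proj1 (LT s) Ts.
pose v := [seq constant (e i) | i <- enum 'I_(context s)].
have ve (i : 'I_(context s)) : nth 0 v i = constant (e i).
  by rewrite (nth_map i) ?size_enum_ord // nth_ord_enum.
have [m [le_nm Em]] := task_recurs (inr (a, v)) n.
have [st' at_m] := at_stage_total m; have [b [st2 [at_m1 Hstep]]] := at_stageS at_m.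
have ext := at_stage_extends le_nm at_n at_m.
have Hf : fires a v st' s.
  split=> //; split.
  - by rewrite size_map size_enum_ord.
  - apply/allP => _ /mapP[i _ ->]; apply: leq_trans (ltc i) _.
    by case: ext.
  - by apply: forces_extends ext (forces_ext _ Hp) => i; rewrite ve.
move: Hstep; rewrite /step Em => -[[s' [[Ls' _] Est2]]|[nf _]]; last by case: (nf s).
have [Lf _ _] := LP; rewrite {}Est2 -(Lf _ _ _ La Ls') in at_m1.
apply: sat_fact pcq at_m1 _ ve.
by apply: List.in_or_app; right; left.
Qed.

(** The antecedent is the initial fact, hence true in the limit; so the succedent is true there, and
    forced at a finite stage. *)
Lemma path_reaches_goal :
  positive_coherent_sequent goal -> true_in path_diagram goal ->
  exists s, initial_segment alpha s /\ reaches_goal s.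
Proof.
move=> /andP[pcp pcq] true_goal.
have init : initial_segment alpha [::] by [].
have at0 : at_stage 0 init_state by exists [::]; split=> //; constructor.
have [e Ee] : exists e : 'I_k -> element,
    forall i : 'I_k, nth 0 init_env i = constant (e i).
  apply: (fin_choice (Q := fun (i : 'I_k) x => nth 0 init_env i = constant x)) => i.
  have [|x Ex] := @element_of (nth 0 init_env i) 0; last by exists x.
  exists init_state; split=> //; rewrite /init_env nth_mkseq //=.
  by rewrite ltn_subrL; case: (i) => j /= /(leq_ltn_trans (leq0n j)).
have sat_p : sat (D := path_diagram) e (antecedent goal).
  by apply: sat_fact pcp at0 (or_introl erefl) Ee.
have [n [st [[s [init_s Es run_s]] Hst]]] :=
  eventually_forces pcq (true_goal e sat_p).
exists s; split=> //; exists st; split=> //.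
by apply: forces_ext Hst => i; rewrite Ee.
Qed.

End Path.

Lemma provable_of_fan :
  FAN_D -> positive_coherent_theory T -> positive_coherent_sequent goal ->
  (forall D, enumerable_diagram D -> model_diagram T D -> true_in D goal) ->
  provable T goal.
Proof.
move=> fanD pcT pc_goal true_goal.
have fan_binary : fan binary.
  split.
    split=> [s _|//|s]; first exact: dec_bool.
    rewrite /binary; split=> [bin_s|[b]]; first by exists 0; rewrite all_rcons.
    by rewrite all_rcons => /andP[].
  by move=> s _; exists 1 => b; rewrite /binary all_rcons => /andP[].
have [||m barm] := fanD binary reaches_goal fan_binary.
- by move=> s _; apply: dec_reaches_goal.
- move=> alpha [fun_alpha _]; apply: (@path_reaches_goal _ fun_alpha) => //.
  by apply: true_goal; [apply: path_diagram_enumerable | apply: path_diagram_model].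
have reach s : binary s -> size s = m -> reaches_goal s.
  (* The path extends [s] by zeros, through the default value of [nth]; the bar meets it within [s],
     as [m] is the size of [s]. *)
  move=> bin_s Es; pose alpha i b := b = nth 0 s i.
  have [|t [init_t le_tm [st [run_t Hst]]]] := barm alpha.
    split=> [i|t init_t]; first by exists (nth 0 s i); split=> [|b ->].
    apply/(all_nthP 0) => i /init_t ->.
    case: (ltnP i (size s)) => [lt_i|ge_i]; first exact: (all_nthP 0 bin_s).
    by rewrite nth_default.
  have Et : t = take (size t) s.
    apply: (@eq_from_nth _ 0) => [|i lt_i]; first by rewrite size_takel ?Es.
    by rewrite nth_take // (init_t i lt_i).
  have [st' run_s] := run_total s; exists st'; split=> //.
  (* The goal forced at the prefix [t] stays forced at [s]. *)
  apply: forces_extends Hst; apply: (@run_extends t (drop (size t) s)) => //.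
  by rewrite Et size_takel ?Es // cat_take_drop.
have := derives_goal_run reach (isT : binary [::]) (leq0n m) run_nil.
move=> /(_ [:: antecedent goal] id); rewrite subst_id //; apply.
- move=> _ [<-|[]] /=; exists id; rewrite subst_id //; split; last by left.
  by move=> i; rewrite nth_mkseq.
- by move=> i; rewrite nth_mkseq.
Qed.

End Chase.

Lemma completeness_of_fan : FAN_D -> enumerable_completeness.
Proof.
move=> fanD S T pcT [enumS enumT] goal pc_goal true_goal.
have [L LP] := enumerable_listing enumT.
have decS (R R' : symbol S) : dec (R = R') by apply: enumerable_eq_dec enumS _ _.
exact: provable_of_fan decS LP goal fanD pcT pc_goal true_goal.
Qed.

Theorem theorem2p14 : enumerable_completeness <-> FAN_D.
Proof. by split; [apply: fan_of_completeness | apply: completeness_of_fan]. Qed.
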